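(* There exist infinitely many (pairwise non-isomorphic) $4$-connected $1$-plane graphs that have no $2$-connected spanning plane subgraphs.
   Context: All graphs are finite, simple and undirected. A (plane) drawing of a graph represents the vertices by distinct points of the plane and the edges by non-self-intersecting arcs joining the points of their end vertices and containing no vertex point in their interior. A $1$-plane graph is a graph given together with a plane drawing in which each edge is crossed at most once by another edge, i.e. each edge has at most one crossing point; crossings of adjacent edges are forbidden. A spanning plane subgraph of a $1$-plane graph $G$ is a subgraph $F$ with $V(F)=V(G)$ that is a plane graph with respect to the given drawing of $G$, i.e. no two edges of $F$ cross in that drawing. The connectivity is $\kappa(G)=\min\{p(u,v) : u,v\in V(G), u\neq v\}$, where $p(u,v)$ is the maximum number of pairwise internally vertex-disjoint $uv$-paths; $G$ is $k$-connected if $\kappa(G)\ge k$. *)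

(* Defs.v *)
(* MathComp world: finite graphs over a finType, drawings in the plane R * R
   for a MathComp-Analysis realType R. *)
From HB Require Import structures.
From mathcomp Require Import all_boot all_order all_algebra.
From mathcomp Require Import all_classical all_reals all_analysis.

Set Implicit Arguments.
Unset Strict Implicit.
Unset Printing Implicit Defensive.

Import Order.TTheory GRing.Theory Num.Theory.
Import numFieldNormedType.Exports.

Local Open Scope classical_set_scope.
Local Open Scope ring_scope.

Record sgraph (T : finType) := SGraph {
  adj :> rel T;
  adj_sym : symmetric adj;
  adj_irr : irreflexive adj
}.

Section Connectivity.
Variables (T : finType) (G : sgraph T).

(* A uv-path is encoded by the sequence of its internal vertices; the empty
   sequence is the path consisting of the single edge uv. *)
Definition uv_path (u v : T) (s : seq T) : bool :=
  path G u (rcons s v) && uniq (u :: rcons s v).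

Definition internally_disjoint (P : {set #|T|.-bseq T}) : bool :=
  [forall s in P, forall t in P, (s != t) ==> ~~ has [in t] s].

Definition local_connectivity (u v : T) : nat :=
  \max_(P : {set #|T|.-bseq T} |
        [forall s in P, uv_path u v s] && internally_disjoint P) #|P|.

(* Every local connectivity is at most #|T| - 1, so the initial value of the
   minimum only matters when there is no pair u != v; the one-vertex graph
   then gets connectivity 0. *)
Definition connectivity : nat :=
  \big[minn/#|T|.-1]_(uv : T * T | uv.1 != uv.2) local_connectivity uv.1 uv.2.

Definition k_connected (k : nat) : bool := (k <= connectivity)%N.

Definition edges : {set {set T}} :=
  [set e : {set T} | [exists x, exists y, G x y && (e == [set x; y]%SET)]].

End Connectivity.

Definition isomorphic (S T : finType) (G : sgraph S) (H : sgraph T) : Prop :=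
  exists2 f : S -> T, bijective f & forall x y, H (f x) (f y) = G x y.

Section Drawing.
Variable R : realType.

Notation plane := (R * R)%type.

(* Near p the sets A and B look like two crossing lines: a homeomorphism from
   an open neighbourhood U of p onto an open neighbourhood V of the origin
   carries A and B to the two coordinate axes.  In particular A and B do not
   merely touch at p. *)
Definition crossing_point (A B : set plane) (p : plane) : Prop :=
  exists (U V : set plane) (h k : plane -> plane),
    [/\ open_nbhs p U, open_nbhs (0, 0) V & h p = (0, 0)] /\
    [/\ {within U, continuous h}, {within V, continuous k},
        forall q, U q -> V (h q) /\ k (h q) = q &
        forall q, V q -> U (k q) /\ h (k q) = q] /\
    forall q, U q -> (A q <-> (h q).2 = 0) /\ (B q <-> (h q).1 = 0).

(* The arc of an edge e is parametrized by `[0, 1]; the values of [arc] on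
   sets that are not edges, and outside `[0, 1], are irrelevant. *)
Record drawing (T : finType) (G : sgraph T) := Drawing {
  point : T -> plane;
  arc : {set T} -> R -> plane;
  point_inj : injective point;
  arc_continuous : forall e, e \in edges G ->
    {within `[0, 1], continuous (arc e)};
  arc_inj : forall e, e \in edges G -> {in `[0, 1] &, injective (arc e)};
  arc_ends : forall e, e \in edges G ->
    exists x y, [/\ e = [set x; y]%SET, arc e 0 = point x & arc e 1 = point y];
  arc_avoids_points : forall e, e \in edges G ->
    forall v, ~ (arc e @` `]0, 1[) (point v);
  arc_meets_crossing : forall e f, e \in edges G -> f \in edges G -> e != f ->
    forall p, (arc e @` `]0, 1[) p -> (arc f @` `]0, 1[) p ->
    crossing_point (arc e @` `]0, 1[) (arc f @` `]0, 1[) p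
}.

Definition cross_at (T : finType) (G : sgraph T) (D : drawing G)
    (e f : {set T}) (p : plane) : Prop :=
  [/\ e \in edges G, f \in edges G, e != f &
      crossing_point (arc D e @` `]0, 1[) (arc D f @` `]0, 1[) p].

Definition cross (T : finType) (G : sgraph T) (D : drawing G)
    (e f : {set T}) : Prop :=
  exists p, cross_at D e f p.

Record oneplane_graph := OnePlaneGraph {
  vertex : finType;
  graph :> sgraph vertex;
  draw : drawing graph;
  one_crossing : forall e f g p q,
    cross_at draw e f p -> cross_at draw e g q -> f = g /\ p = q;
  adjacent_no_cross : forall x y z : vertex,
    ~ cross draw [set x; y]%SET [set x; z]%SET
}.

(* A spanning subgraph is a graph F on the same vertex type. *)
Definition spanning_plane_subgraph (G : oneplane_graph)
    (F : sgraph (vertex G)) : Prop :=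
  subrel F G /\
  forall e f, e \in edges F -> f \in edges F -> ~ cross (draw G) e f.

End Drawing.

(* Main.v *)
(* Six gadgets, each a copy of K4 whose four corners all carry one outgoing edge
   (a "link"), are joined by twelve links.  Orient the links so that every
   gadget has two links leaving it and two entering it; in the drawing the two
   links leaving a gadget cross each other.  A plane subgraph thus keeps at most
   one link out of each gadget, and a 2-connected spanning one would make the
   kept links a directed Hamiltonian cycle on the gadgets.  The underlying
   oriented plane multigraph is the closure of a braid on four strands, in which
   every family of kept links meeting each gadget once winds twice around the
   centre; being non-crossing, it is not a single cycle.

   The graph is 4-connected because the gadgets are complete and the multigraph
   of links is 4-edge-connected, through Menger's theorem.  To obtain infinitely
   many graphs, one diagonal of one gadget is replaced with a path (the
   "strand") of arbitrary length all of whose inner vertices are joined to the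
   other two corners.  All drawings are straight-line drawings; two segments are
   shown to be disjoint by exhibiting a weakly separating line. *)
From Stdlib Require Import BinInt.
Require Import Defs.
From mathcomp Require Import all_boot all_order all_algebra.
From mathcomp Require Import all_classical all_reals all_analysis.
From mathcomp Require Import zify ssrZ ring lra.

Set Implicit Arguments.
Unset Strict Implicit.
Unset Printing Implicit Defensive.

(** * Menger's theorem *)

Section Menger.
Variable T : finType.
Implicit Types (e : rel T) (A B S X Y : {set T}) (p q s : seq T).

(** A route lists all its vertices, so a point of [A :&: B] alone is a route, and
    [uniq (flatten ps)] says at once that the routes in [ps] are simple and pairwise disjoint. *)
Definition route e A B p :=
  if p is x :: s then [&& x \in A, path e x s & last x s \in B] else false.

Definition separates e A B S := forall p, route e A B p -> has [in S] p.

(** The path is cut at its first vertex in [X]: all arcs before it leave vertices outside [X] and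
    hence belong to [e']. *)
Lemma path_prefix e e' X x s :
  (forall a b, e a b -> a \notin X -> e' a b) ->
  path e x s -> has [in X] (x :: s) ->
  exists s', [/\ path e' x s', last x s' \in X & {subset x :: s' <= x :: s}].
Proof.
move=> ee'; elim: s x => [|b s IH] x /=.
  by move=> _; rewrite orbF => xX; exists [::]; split.
case/andP=> exb ps; case xX: (x \in X) => /=.
  by move=> _; exists [::]; split=> // z; rewrite !inE => ->.
move=> /(IH _ ps) [s' [ps' ls' sub]]; exists (b :: s'); split => //=.
  by rewrite ee' ?xX.
move=> z; rewrite in_cons => /orP[/eqP->|/sub]; first by rewrite mem_head.
by move=> zs; rewrite in_cons zs orbT.
Qed.

Lemma sub_path_notin e e' Y x s :
  (forall a b, e a b -> b \notin Y -> e' a b) ->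
  path e x s -> ~~ has [in Y] s -> path e' x s.
Proof.
move=> ee'; elim: s x => [|b s IH] x //= /andP[exb ps].
by rewrite negb_or => /andP[bY /(IH _ ps) ->]; rewrite ee'.
Qed.

(** The path is cut at its last vertex in [Y]: all later arcs enter vertices outside [Y] and hence
    belong to [e']. *)
Lemma path_suffix e e' Y x s :
  (forall a b, e a b -> b \notin Y -> e' a b) ->
  path e x s -> has [in Y] (x :: s) ->
  exists y s', [/\ y \in Y, path e' y s', last y s' = last x s &
                   {subset y :: s' <= x :: s}].
Proof.
move=> ee'; elim: s x => [|b s IH] x.
  by rewrite /= orbF => _ xY; exists x, [::]; split.
move=> /[dup] pxs /= /andP[exb ps].
case hs: (has [in Y] (b :: s)).
  have [y [s' [yY ps' ls' sub]]] := IH _ ps hs => _.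
  exists y, s'; split => // z /sub zs.
  by rewrite in_cons zs orbT.
move/negbT: (hs) => nhs; move: hs => /= ->; rewrite orbF => xY.
by exists x, (b :: s); split => //; apply: sub_path_notin pxs nhs.
Qed.

Lemma mem_flatten (ps : seq (seq T)) p v :
  p \in ps -> v \in p -> v \in flatten ps.
Proof. by move=> pps vp; apply/flattenP; exists p. Qed.

Lemma uniq_flatten_mem (ps : seq (seq T)) p q v :
  uniq (flatten ps) -> p \in ps -> q \in ps -> v \in p -> v \in q -> p = q.
Proof.
elim: ps => //= r ps IH; rewrite cat_uniq => /and3P[_ /hasPn dis ups].
rewrite !inE => /orP[/eqP->|pps] /orP[/eqP->|qps] // vp vq.
- by have /negP[] := dis v (mem_flatten qps vq).
- by have /negP[] := dis v (mem_flatten pps vp).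
- exact: IH.
Qed.

Lemma uniq_flatten_uniq (ps : seq (seq T)) p :
  uniq (flatten ps) -> p \in ps -> uniq p.
Proof.
elim: ps => //= r ps IH; rewrite cat_uniq => /and3P[ur _ ups].
by rewrite inE => /predU1P[->|/IH->].
Qed.

Lemma uniq_flatten_map (ps : seq (seq T)) (f : seq T -> T) :
  uniq (flatten ps) -> (forall p, p \in ps -> f p \in p) -> uniq (map f ps).
Proof.
elim: ps => //= r ps IH; rewrite cat_uniq => /and3P[_ /hasPn dis ups] fP.
rewrite IH // ?andbT; last by move=> p pps; rewrite fP // inE pps orbT.
apply/negP => /mapP[q qps frq].
have frq' : f r \in q by rewrite frq fP // inE qps orbT.
have /negP[] := dis _ (mem_flatten qps frq').
by rewrite /= fP // mem_head.
Qed.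

Lemma uniq_map_flatten (s : seq T) (f : T -> seq T) :
  uniq s -> {in s, forall z, uniq (f z)} ->
  {in s &, forall z z', forall v, v \in f z -> v \in f z' -> z = z'} ->
  uniq (flatten (map f s)).
Proof.
elim: s => //= z s IH /andP[zs us] uf dis.
rewrite cat_uniq uf ?mem_head // IH //; last first.
- by move=> a b aS bS; apply: dis; rewrite inE ?aS ?bS orbT.
- by move=> a aS; apply: uf; rewrite inE aS orbT.
rewrite andbT /=; apply/hasPn => v /flatten_mapP[z' z's vz'].
apply/negP => vz; move: zs.
by rewrite (dis z z' _ _ v) ?z's // inE ?eqxx // z's orbT.
Qed.

Lemma in_split (v : T) p : v \in p -> exists p1 p2, p = p1 ++ v :: p2.
Proof. by case/splitPr => p1 p2; exists p1, p2. Qed.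

Lemma route_sub e e' A B : subrel e e' -> subpred (route e A B) (route e' A B).
Proof.
by move=> sub [|x s] //= /and3P[-> /(sub_path sub) -> ->].
Qed.

Lemma route_splice e A B X Y p1 p2 q1 q2 v :
  route e A X (p1 ++ v :: p2) -> route e Y B (q1 ++ v :: q2) ->
  route e A B (p1 ++ v :: q2).
Proof.
case: p1 q1 => [|a p1] [|b q1] /=; rewrite ?cat_path ?last_cat /=.
- by move=> /and3P[-> _ _] /and3P[_ -> ->].
- by move=> /and3P[-> _ _] /and3P[_ /and3P[_ _ ->] ->].
- by move=> /and3P[-> /and3P[-> -> _] _] /and3P[_ -> ->].
- by move=> /and3P[-> /and3P[-> -> _] _] /and3P[_ /and3P[_ _ ->] ->].
Qed.

(* A system of #|X| disjoint routes whose [f]-ends lie in X has exactly one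
   route at each point of X. *)
Lemma routes_by_end (X : {set T}) (f : seq T -> T) (ps : seq (seq T)) :
  uniq (flatten ps) -> (forall p, p \in ps -> f p \in p /\ f p \in X) ->
  size ps = #|X| ->
  exists P : T -> seq T, [/\ forall z, z \in X -> P z \in ps,
    forall z, z \in X -> f (P z) = z,
    forall z, z \in X -> uniq (P z) &
    forall z z' v, z \in X -> z' \in X -> v \in P z -> v \in P z' -> z = z'].
Proof.
move=> ups fP sz.
have um : uniq (map f ps) by apply: uniq_flatten_map => // p /fP[].
have mm : map f ps =i enum X.
  apply: (uniq_min_size um _ _).2; last by rewrite size_map sz cardE.
  by move=> z /mapP[p /fP[_ pX] ->]; rewrite mem_enum.
pose P z := nth [::] ps (index z (map f ps)).
have iP z : z \in X -> index z (map f ps) < size ps.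
  by move=> zX; rewrite -(size_map f) index_mem mm mem_enum.
have Pin z : z \in X -> P z \in ps by move=> zX; rewrite mem_nth ?iP.
have Pf z : z \in X -> f (P z) = z.
  move=> zX; rewrite /P -(nth_map _ z) ?iP // nth_index //.
  by rewrite mm mem_enum.
exists P; split=> // [z zX|z z' v zX z'X vz vz'].
  exact: uniq_flatten_uniq ups (Pin z zX).
rewrite -(Pf z zX) -(Pf z' z'X).
by rewrite (uniq_flatten_mem ups (Pin z zX) (Pin z' z'X) vz vz').
Qed.

(* A common vertex of a route from A to S + x and of a route from S + y to B
   gives an [e']-route from A to B, which has to go through S; so routes meet
   only at their ends in S, and can be glued there, or along the edge (x, y). *)
Section Gluing.
Variables (e : rel T) (A B S : {set T}) (x y : T).
Let e' : rel T := fun a b => e a b && ((a, b) != (x, y)).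
Hypotheses (exy : e x y) (xS : x \notin S) (yS : y \notin S).
Hypothesis sepS : separates e' A B S.
Variables ps qs : seq (seq T).
Hypotheses (size_ps : size ps = #|S|.+1) (size_qs : size qs = #|S|.+1).
Hypotheses (routes_ps : all (route e' A (x |: S)) ps).
Hypotheses (routes_qs : all (route e' (y |: S) B) qs).
Hypotheses (uniq_ps : uniq (flatten ps)) (uniq_qs : uniq (flatten qs)).

Lemma glue_routes : exists rs,
  [/\ size rs = #|S|.+1, all (route e A B) rs & uniq (flatten rs)].
Proof.
have [P [Pin Pl Pu Pd]] : exists P : T -> seq T,
    [/\ forall z, z \in x |: S -> P z \in ps,
    forall z, z \in x |: S -> last x (P z) = z,
    forall z, z \in x |: S -> uniq (P z) &
    forall z z' v, z \in x |: S -> z' \in x |: S ->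
      v \in P z -> v \in P z' -> z = z'].
  apply: routes_by_end => //; last by rewrite cardsU1 xS.
  move=> [|a s] /(allP routes_ps) //= /and3P[_ _ lX].
  by rewrite mem_last.
have [Q [Qin Ql Qu Qd]] : exists Q : T -> seq T,
    [/\ forall z, z \in y |: S -> Q z \in qs,
    forall z, z \in y |: S -> head x (Q z) = z,
    forall z, z \in y |: S -> uniq (Q z) &
    forall z z' v, z \in y |: S -> z' \in y |: S ->
      v \in Q z -> v \in Q z' -> z = z'].
  apply: routes_by_end => //; last by rewrite cardsU1 yS.
  move=> [|a s] /(allP routes_qs) //= /and3P[aY _ _].
  by rewrite mem_head.
have xX : x \in x |: S by rewrite setU11.
have yY : y \in y |: S by rewrite setU11.
have SX z : z \in S -> z \in x |: S by move=> zS; rewrite inE zS orbT.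
have SY z : z \in S -> z \in y |: S by move=> zS; rewrite inE zS orbT.
have Pcons z : z \in x |: S -> exists a s,
    [/\ P z = a :: s, a \in A, path e' a s & last a s = z].
  move=> zX; have := allP routes_ps _ (Pin z zX); have := Pl z zX.
  by case: (P z) => //= a s <- /and3P[]; exists a, s.
have Qcons z : z \in y |: S -> exists s,
    [/\ Q z = z :: s, path e' z s & last z s \in B].
  move=> zX; have := allP routes_qs _ (Qin z zX); have := Ql z zX.
  by case: (Q z) => //= a s <- /and3P[]; exists s.
have meet z z' v : z \in x |: S -> z' \in y |: S -> v \in P z -> v \in Q z' ->
    [/\ v \in S, z = v & z' = v].
  move=> zX z'Y vz vz'.
  suff vS : v \in S.
    split=> //.
      have [a [s [Pv _ _ lv]]] := Pcons v (SX v vS).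
      by apply: (Pd z v v) => //; [exact: SX|rewrite Pv -{1}lv mem_last].
    have [s [Qv _ _]] := Qcons v (SY v vS).
    by apply: (Qd z' v v) => //; [exact: SY|rewrite Qv mem_head].
  have [a [s [Pz aA pas laz]]] := Pcons z zX.
  have [s' [Qz' ps' lB]] := Qcons z' z'Y.
  have uP := Pu z zX; have uQ := Qu z' z'Y.
  move: vz; rewrite Pz => /in_split[p1 [p2 Ep]].
  move: vz'; rewrite Qz' => /in_split[q1 [q2 Eq]].
  move: (uP) (uQ); rewrite Pz Qz' Ep Eq => uP' uQ'.
  have lz : last v p2 = z by have := congr1 (last a) Ep; rewrite last_cat /= laz.
  (* The start of [P z] up to [v], continued along [Q z'], is an [e']-route from [A] to [B], so it
     has a vertex [t] in [S]. As [P t] ends and [Q t] starts at [t], disjointness makes [t] an end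
     of [P z] or of [Q z']; simplicity then leaves only [t = v]. *)
  have hit : has [in S] (p1 ++ v :: q2).
    apply: sepS; apply: (@route_splice _ _ _ (x |: S) (y |: S) _ p2 q1).
      by rewrite -Ep /= aA pas laz.
    by rewrite -Eq /= z'Y ps'.
  case/hasP: hit => t; rewrite mem_cat => tpq tS.
  have tz : t \in P z -> t = z.
    have [b [r [Pt _ _ lt]]] := Pcons t (SX t tS).
    move=> tPz; apply: (Pd t z t) => //; [exact: SX|by rewrite Pt -{1}lt mem_last].
  have tz' : t \in Q z' -> t = z'.
    have [r [Qt _ _]] := Qcons t (SY t tS).
    move=> tQz; apply: (Qd t z' t) => //; [exact: SY|by rewrite Qt mem_head].
  case/orP: tpq => [tp1|].
    have {}tz : t = z by apply: tz; rewrite Pz Ep mem_cat tp1.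
    move: uP'; rewrite cat_uniq => /and3P[_ /hasPn nh _].
    have := nh z; rewrite -{1}lz mem_last => /(_ isT) /=.
    by rewrite -tz tp1.
  rewrite inE => /predU1P[<-//|tq2].
  have {}tz' : t = z' by apply: tz'; rewrite Qz' Eq mem_cat inE tq2 !orbT.
  case: q1 Eq uQ' => [[<- _] _|c q1 [<- _]].
    by rewrite -tz'.
  by rewrite /= mem_cat inE -tz' tq2 !orbT.
(* The route ending at [x] is continued across the edge by the one starting at [y]; any other route
   by the one starting at its own end, which [tl] drops so as not to repeat it. *)
pose m z := if z == x then y else z.
have mY z : z \in x |: S -> m z \in y |: S.
  by rewrite /m !inE; case: eqP => _ /=; [rewrite eqxx|move=> ->; rewrite orbT].
have m_inj : {in x |: S &, injective m}.
  move=> a b; rewrite !inE /m; case: eqP => [->|_] /=; case: eqP => [->|_] //=.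
    by move=> _ bS yb; move: yS; rewrite yb bS.
  by move=> aS _ ay; move: yS; rewrite -ay aS.
pose tl z := if z == x then Q y else behead (Q z).
have tlQ z v : z \in x |: S -> v \in tl z -> v \in Q (m z).
  by rewrite /tl /m; case: eqP => _ // _; apply: mem_behead.
have meet_tl z z' v : z \in x |: S -> z' \in x |: S ->
    v \in P z -> v \notin tl z'.
  move=> zX z'X vz; apply/negP => vt.
  have [vS zv] := meet _ _ _ zX (mY _ z'X) vz (tlQ _ _ z'X vt).
  move: vt; rewrite /tl /m; case: eqP => [_ _ yv|/eqP nz' + z'v].
    by move: yS; rewrite yv vS.
  have z'Y : z' \in y |: S by apply: SY; rewrite z'v.
  have := Qu _ z'Y; have [s [-> _ _]] := Qcons z' z'Y.
  by rewrite /= z'v => /andP[/negbTE->].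
pose g z := P z ++ tl z.
have xuS : uniq (x :: enum S) by rewrite /= mem_enum xS enum_uniq.
have inX z : z \in x :: enum S -> z \in x |: S by rewrite !inE mem_enum.
exists [seq g z | z <- x :: enum S]; split.
- by rewrite size_map /= -cardE.
- apply/allP => _ /mapP[z /inX zX ->]; rewrite /g /tl.
  have [a [s [-> aA pas laz]]] := Pcons z zX.
  have [s' [Qz' ps' lB]] := Qcons (m z) (mY z zX).
  have sub : subrel e' e by move=> ? ? /andP[].
  move: Qz' ps' lB; rewrite /m; case: eqP => [zx|_] -> ps' lB.
    rewrite /= aA cat_path (sub_path sub pas) laz zx /= exy (sub_path sub ps').
    by rewrite last_cat.
  by rewrite /= aA cat_path (sub_path sub pas) laz (sub_path sub ps') last_cat laz.
- apply: uniq_map_flatten => // [z /inX zX|z z' /inX zX /inX z'X v].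
    rewrite /g cat_uniq Pu //=; apply/andP; split.
      by apply/hasPn => v; apply: contraL => /(meet_tl z z) ->.
    rewrite /tl; case: eqP => [_|/eqP nz]; first exact: Qu.
    have := Qu _ (mY _ zX); rewrite /m (negbTE nz).
    by case: (Q z) => //= ? ? /andP[].
  rewrite !mem_cat => /orP[vz|vz] /orP[vz'|vz'].
  - exact: Pd vz vz'.
  - by have := meet_tl z z' v zX z'X vz; rewrite vz'.
  - by have := meet_tl z' z v z'X zX vz'; rewrite vz.
  - by apply: m_inj => //; apply: (Qd _ _ v); rewrite ?mY ?tlQ.
Qed.
End Gluing.

(* Göring's induction on the number of edges. *)
Theorem menger e A B k : (forall S, separates e A B S -> k <= #|S|) ->
  exists ps, [/\ size ps = k, all (route e A B) ps & uniq (flatten ps)].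
Proof.
have [n] := ubnP #|[set xy | e xy.1 xy.2]|.
elim: n e A B k => // n IH e A B k le_n sepk.
have [[x y] /= exy|e0] := pickP (fun xy => e xy.1 xy.2); last first.
  (* Without edges a route is a single vertex, so [A :&: B] separates. *)
  have kAB : k <= #|A :&: B|.
    apply: sepk => -[|a [|b s]] //=; first by rewrite inE orbF => /andP[-> ->].
    by have /= -> := e0 (a, b); rewrite andbF.
  have ft : flatten [seq [:: z] | z <- take k (enum (A :&: B))] =
            take k (enum (A :&: B)) by rewrite flatten_seq1.
  exists [seq [:: z] | z <- take k (enum (A :&: B))]; split.
  - by rewrite size_map size_takel // -cardE.
  - apply/allP => _ /mapP[z /mem_take + ->].
    by rewrite mem_enum inE => /andP[zA zB]; rewrite /= zA.
  - by rewrite ft take_uniq // enum_uniq.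
pose e' : rel T := fun a b => e a b && ((a, b) != (x, y)).
have sub : subrel e' e by move=> ? ? /andP[].
have lt_n : #|[set xy | e' xy.1 xy.2]| < n.
  apply: leq_trans (_ : #|[set xy | e xy.1 xy.2]| <= n); last exact: le_n.
  apply: proper_card; apply/properP; split.
    by apply/fintype.subsetP => -[a b]; rewrite !inE => /sub.
  by exists (x, y); rewrite !inE //= /e' exy eqxx.
have [sepk'|] := pselect (forall S, separates e' A B S -> k <= #|S|).
  have [ps [szps rps ups]] := IH e' A B k lt_n sepk'.
  by exists ps; split=> //; apply: sub_all rps; apply: route_sub.
(* Otherwise some [S] with fewer than [k] vertices separates once [(x, y)] is deleted. Both [x |: S]
   and [y |: S] separate in [e], so [S] has exactly [k - 1] vertices and contains neither [x] nor
   [y]. *)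
move=> /existsNP[S /not_implyP[sepS /negP]]; rewrite -ltnNge => ltS.
have eX z a b : e a b -> a \notin x |: z -> e' a b.
  by rewrite /e' xpair_eqE !inE negb_or => -> /andP[/negbTE->].
have eY z a b : e a b -> b \notin y |: z -> e' a b.
  by rewrite /e' xpair_eqE !inE negb_or => -> /andP[/negbTE->]; rewrite andbF.
have sepX : separates e A B (x |: S).
  move=> p rp; apply: contraT => nX; suff /sepS : route e' A B p.
    by case/hasP => t tp tS; move/hasPn/(_ t tp): nX; rewrite /= inE tS orbT.
  case: p rp nX => //= a s /and3P[-> pas ->]; rewrite andbT /=.
  elim: s a pas => //= b s IHs a /andP[eab pbs] /norP[aX nb].
  by apply/andP; split; [exact: eX aX|exact: IHs].
have kX : k <= #|x |: S| by exact: sepk.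
have [xS Sk] : x \notin S /\ #|S|.+1 = k.
  move: kX; rewrite cardsU1; case: (x \in S) => /= kS; last by split=> //; lia.
  by move: kS; rewrite add0n leqNgt ltS.
have sepY : separates e A B (y |: S).
  move=> p rp; apply: contraT => nY; suff /sepS : route e' A B p.
    by case/hasP => t tp tS; move/hasPn/(_ t tp): nY; rewrite /= inE tS orbT.
  case: p rp nY => //= a s /and3P[-> pas ->] /norP[_ nY]; rewrite andbT /=.
  exact: sub_path_notin (eY S) pas nY.
have yS : y \notin S.
  have := sepk _ sepY; rewrite cardsU1 -Sk; case: (y \in S) => //.
  by rewrite add0n ltnn.
(* Each [e]-route from [A] to [B] hits [x |: S], and its part up to the first hit is an [e']-route,
   which meets [Z]. Thus [Z] separates [A] from [B] in [e]. *)
have sepkX Z : separates e' A (x |: S) Z -> k <= #|Z|.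
  move=> sepZ; apply: sepk => -[//|a s] rp.
  have := sepX _ rp; case/and3P: rp => aA pas lB hX.
  have [s' [ps' ls' sub']] := path_prefix (eX S) pas hX.
  have /hasP[t ts tZ] := sepZ (a :: s') ltac:(by rewrite /= aA ps').
  by apply/hasP; exists t => //; apply: sub'.
have sepkY Z : separates e' (y |: S) B Z -> k <= #|Z|.
  move=> sepZ; apply: sepk => -[//|a s] rp.
  have := sepY _ rp; case/and3P: rp => aA pas lB hY.
  have [b [s' [bY ps' ls' sub']]] := path_suffix (eY S) pas hY.
  have /hasP[t ts tZ] := sepZ (b :: s') ltac:(by rewrite /= bY ps' ls').
  by apply/hasP; exists t => //; apply: sub'.
have [ps [szps rps ups]] := IH _ _ _ _ lt_n sepkX.
have [qs [szqs rqs uqs]] := IH _ _ _ _ lt_n sepkY.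
rewrite -Sk in szps szqs.
rewrite -Sk.
exact: (@glue_routes e A B S x y exy xS yS sepS ps qs szps szqs rps rqs ups uqs).
Qed.
End Menger.

(** * Connectivity and vertex cuts *)

Section Cuts.
Variables (T : finType) (G : sgraph T).
Implicit Types S : {set T}.

Definition avoid S : rel T := fun x y => [&& G x y, x \notin S & y \notin S].

Lemma avoid_sym S : symmetric (avoid S).
Proof. by move=> x y; rewrite /avoid adj_sym [(_ \notin _) && _]andbC. Qed.

(** A simple path never returns to [u], so after its first step it avoids [u] too. *)
Lemma connect_first S u w : connect (avoid S) u w -> u != w ->
  exists a, [/\ G u a, a \notin u |: S & connect (avoid (u |: S)) a w].
Proof.
case/connectP => p /shortenP[[|a s] /= pau uau _ -> nuw]; first by rewrite eqxx in nuw.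
case/andP: pau uau => /and3P[Gua uS aS] pas /andP[ua uas]; exists a; split=> //.
  by rewrite !inE negb_or aS andbT; apply: contraNneq ua => ->; rewrite mem_head.
apply/connectP; exists s => //; move: ua pas.
elim: s a aS {Gua uas nuw} => //= b s IHs a aS; rewrite !inE !negb_or.
case/and3P=> ua ub us /andP[/and3P[Gab _ bS] pbs].
rewrite /avoid Gab !inE !negb_or aS bS ![_ == u]eq_sym ua ub /=.
by apply: IHs => //; rewrite inE negb_or ub.
Qed.

(** An edge [uv] already is one path, so only [k - G u v] routes are asked for between the
    neighbourhoods of [u] and [v], away from both. These routes are the internal parts of
    [uv]-paths. *)
Lemma menger_routes k u v :
  (forall S, #|S| < k -> forall a b, a \notin S -> b \notin S -> connect (avoid S) a b) ->
  k < #|T| -> u != v ->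
  exists ps, [/\ size ps = k - G u v,
    all (route (avoid [set u; v]) [set a in ~: [set u; v] | G u a]
               [set a in ~: [set u; v] | G v a]) ps & uniq (flatten ps)].
Proof.
move=> conn kT uv; apply: menger => S sepS; rewrite leqNgt; apply/negP => ltS.
pose S' := S :\: [set u; v].
have S'S : #|S'| <= #|S| by apply/subset_leq_card/subsetDl.
have uS' : u \notin S' by rewrite !inE eqxx.
have vS' : v \notin S' by rewrite !inE eqxx orbT.
have [a [b [Gua Gvb aZ bZ cab]]] : exists a b, [/\ G u a, G v b,
    a \notin v |: (u |: S'), b \notin v |: (u |: S') &
    connect (avoid (v |: (u |: S'))) a b].
  (* For adjacent [u] and [v] the set [S] is smaller by one, so the graph stays connected when [u]
     or [v] is deleted along with [S']: each of the two reaches a third vertex [w] without the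
     other. Otherwise a [uv]-path avoiding [S'] is stripped of both ends. *)
  case Guv: (G u v) ltS => /= ltS.
    rewrite subn1 in ltS.
    have [w wZ] : exists w, w \notin v |: (u |: S').
      apply/existsP; rewrite -negb_forall; apply/negP => /forallP all_in.
      have : #|T| <= #|v |: (u |: S')|.
        by rewrite -cardsT; apply/subset_leq_card/fintype.subsetP => z _.
      by rewrite !cardsU1; lia.
    move: (wZ); rewrite !in_setU1 !negb_or => /and3P[wv wu wS'].
    have [a [Gua aZ caw]] : exists a, [/\ G u a, a \notin u |: (v |: S') &
        connect (avoid (u |: (v |: S'))) a w].
      apply: connect_first; last by rewrite eq_sym.
      apply: conn; rewrite ?cardsU1 ?in_setU1 ?negb_or ?uS' ?uv ?wv ?wS' //; lia.
    have [b [Gvb bZ cbw]] : exists b, [/\ G v b, b \notin v |: (u |: S') &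
        connect (avoid (v |: (u |: S'))) b w].
      apply: connect_first; last by rewrite eq_sym.
      apply: conn; rewrite ?cardsU1 ?in_setU1 ?negb_or ?vS' ?wu ?wS' //.
        by lia.
      by rewrite eq_sym uv.
    rewrite finset.setUCA in aZ caw; exists a, b; split=> //.
    apply: connect_trans caw _.
    by rewrite (sym_connect_sym (@avoid_sym _)).
  rewrite subn0 in ltS.
  have [a [Gua aZ cav]] := connect_first (conn S' ltac:(lia) u v uS' vS') uv.
  have av : a != v by apply: contraFneq Guv => <-.
  rewrite (sym_connect_sym (@avoid_sym _)) in cav.
  have [b [Gvb bZ cba]] := connect_first cav ltac:(by rewrite eq_sym).
  exists a, b; split=> //; first by rewrite in_setU1 negb_or av.
  by rewrite (sym_connect_sym (@avoid_sym _)).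
have uvZ z : z \notin v |: (u |: S') -> z \notin [set u; v] /\ z \notin S.
  move=> zZ; have : [&& z != v, z != u & z \notin S'].
    by move: zZ; rewrite in_setU1 in_setU1 !negb_or.
  case/and3P=> zv zu; rewrite finset.in_setD in_set2 negb_or zu zv => zS.
  by split.
case/connectP: cab => p pap lp; subst b.
have pZ : all [predC (v |: (u |: S'))] p.
  elim: p a pap {Gua Gvb aZ bZ} => //= b p IH a /andP[/and3P[_ _ bZ] pbp].
  by rewrite /= bZ (IH b).
have [auv aS] := uvZ _ aZ; have [buv bS] := uvZ _ bZ.
have /hasP[t tp tS] : has [in S] (a :: p).
  apply: sepS; rewrite /= !inE Gua Gvb andbT; move: auv buv; rewrite !inE => -> -> /=.
  rewrite andbT; apply: sub_path pap => x y /and3P[Gxy /uvZ[xuv _] /uvZ[yuv _]].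
  by apply/and3P.
have : t \notin v |: (u |: S').
  by move: tp; rewrite inE => /predU1P[->//|/(allP pZ)].
by move=> /uvZ[_]; rewrite tS.
Qed.

Lemma uv_path_route u v p : u != v ->
  route (avoid [set u; v]) [set a in ~: [set u; v] | G u a]
        [set a in ~: [set u; v] | G v a] p -> uniq p -> uv_path G u v p.
Proof.
move=> uv; case: p => // a s /and3P[+ pas +] ups; rewrite !inE !negb_or.
move=> /andP[/andP[au av] Gua] /andP[/andP[lu lv] Gvl].
have /allP suv : all [predC [set u; v]] s.
  elim: s a pas {au av Gua ups lu lv Gvl} => //= b s IH a.
  by case/andP=> /and3P[_ _ ->] /IH ->.
have su : u \notin s by apply/negP => /suv; rewrite /= !inE eqxx.
have sv : v \notin s by apply/negP => /suv; rewrite /= !inE eqxx orbT.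
rewrite /uv_path /= Gua rcons_path adj_sym Gvl andbT.
rewrite (sub_path _ pas) /=; last by move=> x y /andP[].
have := ups; rewrite /= => /andP[as_ us].
rewrite rcons_uniq sv us inE !mem_rcons !inE !negb_or uv su av as_.
by rewrite [u == a]eq_sym au.
Qed.

Theorem k_connected_of_cuts k : k < #|T| ->
  (forall S, #|S| < k -> forall u v, u \notin S -> v \notin S -> connect (avoid S) u v) ->
  k_connected G k.
Proof.
case: k => // k kT conn; rewrite /k_connected /connectivity.
elim/big_ind: _ => [|x y kx ky|[u v] /= uv].
(* The initial value [#|T|.-1] of the minimum is large enough since [k < #|T|]. *)
- by move: kT; case: #|T|.
- by rewrite leq_min kx.
have [ps [szps rps ups]] := menger_routes conn kT uv.
(* The empty sequence encodes the path consisting of the edge [uv]. *)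
pose ps' := if G u v then [::] :: ps else ps.
have pathps : all (uv_path G u v) ps.
  apply/allP => p pps; apply: uv_path_route (allP rps _ pps) _ => //.
  exact: uniq_flatten_uniq ups pps.
have path' : all (uv_path G u v) ps'.
  rewrite /ps'; case Guv: (G u v) => //=; rewrite pathps andbT /uv_path /=.
  by rewrite Guv /= inE uv.
have nil_ps : [::] \notin ps by apply/negP => /(allP rps).
have ups' : uniq ps'.
  suff u_ps : uniq ps by rewrite /ps'; case: (G u v); rewrite //= nil_ps.
  apply: (@map_uniq _ _ (head u)); apply: uniq_flatten_map => // p.
  by case: p => [pps|a s _]; [rewrite pps in nil_ps|rewrite mem_head].
have sz' : size ps' = k.+1.
  by rewrite /ps'; case: (G u v) szps => /= ->; rewrite ?subn1 ?subn0.
pose Q : seq (#|T|.-bseq T) := pmap insub ps'.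
have szQ : size Q = k.+1.
  (* Internal vertices are distinct, so every path respects the length bound [#|T|] and [insub]
     loses none. *)
  rewrite size_pmap_sub -sz'; apply/eqP; rewrite -all_count.
  apply: sub_all path' => p /andP[_ ]; rewrite cons_uniq rcons_uniq => /and3P[_ _ up].
  by rewrite -(card_uniqP up) max_card.
have uQ : uniq Q by apply: pmap_sub_uniq.
rewrite -szQ -(card_uniqP uQ) -cardsE.
apply: (leq_bigmax_cond (F := fun P : {set #|T|.-bseq T} => #|P|)).
apply/andP; split.
  apply/forall_inP => s; rewrite inE mem_pmap_sub => sps.
  exact: (allP path').
apply/forall_inP => s; rewrite inE mem_pmap_sub => sps.
apply/forall_inP => t; rewrite inE mem_pmap_sub => tps.
apply/implyP => st; apply/hasPn => x xs; apply/negP => /= xt.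
have in_ps r : r \in ps' -> x \in r -> r \in ps.
  by rewrite /ps'; case: (G u v) => //; rewrite inE => /predU1P[->|].
have {}sps := in_ps _ sps xs; have {}tps := in_ps _ tps xt.
by move/eqP: st; apply; apply: val_inj; apply: uniq_flatten_mem ups sps tps xs xt.
Qed.

Lemma connectivity_le u v : u != v -> connectivity G <= local_connectivity G u v.
Proof.
move=> uv; rewrite /connectivity.
have : (u, v) \in index_enum (T * T)%type by rewrite mem_index_enum.
elim: (index_enum _) => // -[a b] s IH; rewrite big_cons inE /=.
case/predU1P => [[<- <-]|/IH le_uv]; first by rewrite uv geq_minl.
by case: ifP => // _; apply: leq_trans le_uv; apply: geq_minr.
Qed.

(** A path can leave [A] only from [p]. As [u != p], the vertex [p] is internal to every [uv]-path,
    so no two of them are internally disjoint. *)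
Lemma not_2connected_of_bridge (A : {set T}) p u v :
  (forall x y, G x y -> x \in A -> y \notin A -> x = p) ->
  u \in A -> v \notin A -> u != p -> ~ k_connected G 2.
Proof.
move=> Gp uA vA up; apply/negP; rewrite -ltnNge.
have uv : u != v by apply: contraNneq vA => <-.
apply: leq_ltn_trans (connectivity_le uv) _; rewrite ltnS.
apply/bigmax_leqP => P /andP[/forall_inP pathP /forall_inP disP].
apply/card_le1_eqP => s t sP tP; apply/eqP/negPn/negP => st.
have exit_p (q : seq T) a : a \in A -> a != p -> path G a (rcons q v) -> p \in q.
  elim: q a => [|b q IH] a aA ap /=.
    by rewrite andbT => /Gp/(_ aA vA) E; rewrite E eqxx in ap.
  case/andP=> Gab bq; rewrite inE; case bA: (b \in A).
    by case: (eqVneq p b) => //= pb; apply: (IH b) => //; rewrite eq_sym.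
  by rewrite (Gp _ _ Gab aA (negbT bA)) eqxx in ap.
have through (r : #|T|.-bseq T) : r \in P -> p \in (r : seq T).
  by case/pathP/andP => /(exit_p _ _ uA up).
have /forall_inP/(_ _ sP)/implyP/(_ st)/hasPn/(_ p (through t tP)) := disP t tP.
by rewrite /= through.
Qed.
End Cuts.

(** * The graphs *)

(* The core vertices are 0, ..., 23, and the corners of gadget g are 4g, ...,
   4g + 3 in cyclic order.  Each entry consists of the two links leaving a
   gadget, with their tails first. *)
Definition links : seq ((nat * nat) * (nat * nat)) :=
  [:: ((0, 6), (1, 8)); ((4, 2), (5, 12)); ((10, 7), (11, 22));
      ((14, 3), (15, 18)); ((16, 9), (17, 23)); ((20, 13), (21, 19))].

(** The links form a perfect matching of the 24 corners; this involution exchanges the two ends of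
    each link. *)
Definition mate (i : nat) : nat :=
  nth 0 [:: 6; 8; 4; 14; 2; 12; 0; 10; 1; 16; 7; 22;
            5; 20; 3; 18; 9; 23; 15; 21; 13; 19; 11; 17] i.

(* The diagonal 8-10 of gadget 2 is the one replaced with the strand. *)
Definition core_adj (i j : nat) : bool :=
  (i != j) && ((i %/ 4 == j %/ 4) && ((i, j) \notin [:: (8, 10); (10, 8)])
               || (j == mate i)).

Definition strand_adj (n i k : nat) : bool :=
  (i \in [:: 9; 11]) || ((i, k) \in [:: (8, 0); (10, n)]).

Definition vtype (n : nat) : finType := ('I_24 + 'I_n.+1)%type.

Definition gadj (n : nat) : rel (vtype n) := fun x y =>
  match x, y with
  | inl i, inl j => core_adj i j
  | inl i, inr k => strand_adj n i k
  | inr k, inl i => strand_adj n i k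
  | inr k, inr l => (k.+1 == l) || (l.+1 == k)
  end.

Lemma all_core (P : pred nat) : all P (iota 0 24) -> forall i : 'I_24, P i.
Proof. by move/allP=> allP i; apply: allP; rewrite mem_iota /=. Qed.

Lemma all_core2 (P : rel nat) : all (fun i => all (P i) (iota 0 24)) (iota 0 24) ->
  forall i j : 'I_24, P i j.
Proof. by move=> H i; apply: all_core; apply: (all_core H). Qed.

Lemma gadj_sym n : symmetric (@gadj n).
Proof.
have sym (i j : 'I_24) : core_adj i j == core_adj j i.
  by apply: (@all_core2 (fun i j => core_adj i j == core_adj j i)); vm_compute.
by move=> [i|k] [j|l] //=; [apply/eqP; apply: sym | rewrite orbC].
Qed.

Lemma gadj_irr n : irreflexive (@gadj n).
Proof. by move=> [i|k] //=; rewrite /core_adj ?eqxx //; lia. Qed.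

Definition ggraph n : sgraph (vtype n) := SGraph (@gadj_sym n) (@gadj_irr n).

Definition gadget n (x : vtype n) : nat := if x is inl i then i %/ 4 else 2.

Definition core n (i : nat) : vtype n := inl (inord i).

Lemma core_inj n : {in gtn 24 &, injective (core n)}.
Proof. by move=> i j li lj [] /(congr1 val); rewrite /= !inordK. Qed.

Lemma coreE n (i : 'I_24) : inl i = core n i.
Proof. by rewrite /core inord_val. Qed.

Lemma gadget_core n i : i < 24 -> gadget (core n i) = i %/ 4.
Proof. by move=> li; rewrite /= inordK. Qed.

Lemma core_adjP n i j : i < 24 -> j < 24 ->
  ggraph n (core n i) (core n j) = core_adj i j.
Proof. by move=> li lj; rewrite /= !inordK. Qed.

(* The gadgets, joined by the links, form a 4-edge-connected multigraph. *)
Lemma cut_size (w : nat -> bool) g g' : g < 6 -> g' < 6 -> w g -> ~~ w g' ->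
  4 <= count (fun i => w (i %/ 4) && ~~ w (mate i %/ 4)) (iota 0 24).
Proof.
pose s := [:: w 0; w 1; w 2; w 3; w 4; w 5].
have ws i : i < 6 -> w i = nth false s i by case: i => [|[|[|[|[|[|[|]]]]]]].
move=> lg lg'; rewrite !ws //.
have -> : count (fun i => w (i %/ 4) && ~~ w (mate i %/ 4)) (iota 0 24) =
          count (fun i => nth false s (i %/ 4) && ~~ nth false s (mate i %/ 4)) (iota 0 24).
  by [].
rewrite /s; move: (w 0) (w 1) (w 2) (w 3) (w 4) (w 5).
move: g g' lg lg' {ws s}.
(* Only the values of [w] on the six gadgets matter, so all 64 sets of gadgets can be checked. *)
suff H : forall b0 b1 b2 b3 b4 b5, let s := [:: b0; b1; b2; b3; b4; b5] in
   has id s -> has negb s ->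
  4 <= count (fun i => nth false s (i %/ 4) && ~~ nth false s (mate i %/ 4)) (iota 0 24).
  move=> g g' lg lg' b0 b1 b2 b3 b4 b5 wg wg'; apply: H.
    by apply/(has_nthP false); exists g.
  by apply/(has_nthP false); exists g'.
by do 6!case.
Qed.

Lemma mateP i : i < 24 -> [/\ mate i < 24, mate (mate i) = i & core_adj i (mate i)].
Proof.
move=> li; have := @all_core (fun i => [&& mate i < 24, mate (mate i) == i &
  core_adj i (mate i)]) isT (Ordinal li).
by case/and3P=> ? /eqP ? ?.
Qed.

Lemma gadget_lt n (x : vtype n) : gadget x < 6.
Proof. by case: x => //= i; have := ltn_ord i; lia. Qed.

(* [side] is to be a union of connected components of the graph minus S. *)
Section Sides.
Variables (n : nat) (S : {set vtype n}) (side : pred (vtype n)).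
Hypothesis S_lt4 : #|S| < 4.
Hypothesis sideP : forall x y, ggraph n x y -> x \notin S -> y \notin S ->
  side x = side y.

Let side_core i j : i < 24 -> j < 24 -> core_adj i j ->
  core n i \notin S -> core n j \notin S -> side (core n i) = side (core n j).
Proof. by move=> li lj ij iS jS; apply: sideP; rewrite ?core_adjP. Qed.

(** If both sides occurred, the gadgets with a surviving vertex on [side] would send at least four
    links to the others. Each such link has an end in [S], and links share no corners, so [S] would
    have four vertices. *)
Lemma side_of_gadgets :
  (forall x y, gadget x = gadget y -> x \notin S -> y \notin S -> side x = side y) ->
  forall x y, x \notin S -> y \notin S -> side x -> side y.
Proof.
move=> sideg x y xS yS sx; apply: contraLR S_lt4 => sy; rewrite -leqNgt.
pose w g := [exists z, [&& gadget z == g, z \notin S & side z]].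
have wP z : z \notin S -> w (gadget z) = side z.
  move=> zS; apply/existsP/idP => [[t /and3P[/eqP gt tS st]]|sz].
    by rewrite -(sideg t z).
  by exists z; rewrite eqxx zS.
have := cut_size (gadget_lt x) (gadget_lt y) (w := w).
rewrite !wP // sx sy => /(_ isT isT); rewrite -size_filter.
set L := seq.filter _ _ => size_L; apply: leq_trans size_L _.
pose f i := if core n i \in S then core n i else core n (mate i).
have inL i : i \in L -> [/\ i < 24, w (i %/ 4) & ~~ w (mate i %/ 4)].
  by rewrite mem_filter mem_iota => /andP[/andP[-> ->]].
have fS i : i \in L -> f i \in S.
  case/inL=> li wi wmi; have [lm _ cm] := mateP li.
  rewrite /f; case: ifPn => // iS; apply: contraT => mS.
  have := side_core li lm cm iS mS.
  by rewrite -!wP // !gadget_core // wi (negbTE wmi).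
have uf : uniq (map f L).
  rewrite map_inj_in_uniq ?filter_uniq ?iota_uniq //.
  move=> i j /inL[li wi wmi] /inL[lj wj wmj].
  have [lmi mmi _] := mateP li; have [lmj mmj _] := mateP lj.
  rewrite /f; case: ifP => _; case: ifP => _ /core_inj E.
  - by apply: E.
  - by move: wi; rewrite E // (negbTE wmj).
  - by move: wj; rewrite -E // (negbTE wmi).
  - by rewrite -mmi E.
rewrite -(size_map f) cardE; apply: uniq_leq_size => // _ /mapP[i iL ->].
by rewrite mem_enum fS.
Qed.

Let strand k : vtype n := inr (inord k).

Let side_strand j k : j <= k <= n -> (forall l, j <= l <= k -> strand l \notin S) ->
  side (strand j) = side (strand k).
Proof.
case/andP=> /subnK <- ; move: (k - j) => d {k}; elim: d => // d IH ldn nS.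
rewrite IH; [|lia|by move=> l ?; apply: nS; lia].
apply: sideP; rewrite ?nS //; try lia.
by rewrite /= !inordK //; lia.
Qed.

Lemma strandE (k : 'I_n.+1) : inr k = strand k.
Proof. by rewrite /strand inord_val. Qed.

(** Corners 9 and 11 are adjacent to all other vertices of gadget 2, so either of them connects the
    gadget if it survives. If [S] contains both, it has at most one more vertex, which leaves the
    strand whole or cuts it into at most two pieces, attached to 8 and to 10. *)
Lemma side_gadget2 x y : gadget x = 2 -> gadget y = 2 -> x \notin S -> y \notin S ->
  side x = side y.
Proof.
have hub i : i \in [:: 9; 11] -> core n i \notin S ->
    forall x, gadget x = 2 -> x \notin S -> side x = side (core n i).
  move=> i911 iS {}x; case: (eqVneq x (core n i)) => [->//|xi] gx xS.
  apply: sideP => //; case: x xi gx xS => [j|k] xi gx xS; last first.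
    rewrite /= inordK /strand_adj ?i911 //; move: i911; rewrite !inE; lia.
  have li : i < 24 by move: i911; rewrite !inE; lia.
  rewrite !coreE in xi *; rewrite core_adjP // /core_adj.
  have -> : (j : nat) != i by apply: contraNneq xi => ->.
  have -> : j %/ 4 = 2 by [].
  by move: i911; rewrite !inE => /orP[] /eqP->; rewrite !xpair_eqE !andbF.
move=> gx gy xS yS.
case: (boolP (core n 9 \in S)) => [S9|nS9]; last by rewrite !(hub 9).
case: (boolP (core n 11 \in S)) => [S11|nS11]; last by rewrite !(hub 11).
have two_left (Z : {set vtype n}) : Z \subset S ->
    core n 9 \notin Z -> core n 11 \notin Z -> #|Z| <= 1.
  move=> ZS Z9 Z11; have : #|core n 9 |: (core n 11 |: Z)| <= #|S|.
    apply/subset_leq_card/fintype.subsetP => z; rewrite !inE.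
    by case/or3P => [/eqP->|/eqP->|/(fintype.subsetP ZS)].
  rewrite !cardsU1 in_setU1 negb_or Z9 Z11 /=.
  have -> : core n 9 != core n 11 by apply/eqP => /core_inj; rewrite !inE => /(_ isT isT).
  by rewrite !add1n => le_S; have := leq_ltn_trans le_S S_lt4.
suff [c sc] : exists c, [/\ core n 8 \notin S -> side (core n 8) = c,
    core n 10 \notin S -> side (core n 10) = c &
    forall k, k <= n -> strand k \notin S -> side (strand k) = c].
  have {sc} [s8 s10 ss] := sc.
  suff H z : gadget z = 2 -> z \notin S -> side z = c by rewrite !H.
  case: z => [i|k] gz zS; last first.
    by rewrite strandE; apply: ss; rewrite ?(leq_ord k) // -strandE.
  have : (i : nat) \in [:: 8; 9; 10; 11] by move: gz; rewrite !inE /=; lia.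
  rewrite coreE in zS *.
  rewrite !inE => /or4P[] /eqP E; rewrite E in zS *; first exact: s8.
  - by rewrite S9 in zS.
  - exact: s10.
  - by rewrite S11 in zS.
have adj8 : ggraph n (core n 8) (strand 0) by rewrite /= !inordK.
have adj10 : ggraph n (core n 10) (strand n).
  by rewrite /= !inordK // /strand_adj !inE eqxx orbT.
case: (pselect (exists2 j, j <= n & strand j \in S)) => [[j jn Sj]|noS].
  have onlyS z : z != strand j -> z != core n 9 -> z != core n 11 -> z \notin S.
    move=> zj z9 z11; apply/negP => zS.
    have : #|[set z; strand j]| <= 1.
      apply: two_left; first by apply/fintype.subsetP => t; rewrite !inE => /orP[] /eqP->.
        by rewrite in_set2 negb_or eq_sym z9.
      by rewrite in_set2 negb_or eq_sym z11.
    by rewrite cards2 zj.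
  have coreS i : i < 24 -> i \notin [:: 9; 11] -> core n i \notin S.
    by move=> li; rewrite !inE negb_or => /andP[i9 i11]; apply: onlyS => //;
       rewrite (inj_in_eq (@core_inj n)).
  (* The detour from one end of the cut strand to the other one through the
     gadgets 0 and 1. *)
  have s810 : side (core n 8) = side (core n 10).
    by rewrite (@side_core 8 1) ?(@side_core 1 0) ?(@side_core 0 6) ?(@side_core 6 7)
      ?(@side_core 7 10) // coreS.
  exists (side (core n 8)); split => // k kn Sk.
  have neq_strand l : l <= n -> l != j -> strand l \notin S.
    move=> ln lj; apply: onlyS => //; apply: contraNneq lj => -[] /(congr1 val).
    by rewrite /= !inordK // => ->.
  have kj : k != j by apply: contraNneq Sk => ->.
  case: (ltngtP k j) kj => // kj _.
    have lo l : 0 <= l <= k -> strand l \notin S.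
      case/andP=> _ lk; apply: neq_strand; first exact: leq_trans kn.
      by rewrite ltn_eqF // (leq_ltn_trans lk).
    by rewrite -(@side_strand 0 k) //; apply/esym/sideP; rewrite ?coreS ?lo.
  have hi l : k <= l <= n -> strand l \notin S.
    case/andP=> kl ln; apply: neq_strand => //.
    by rewrite gtn_eqF // (leq_trans kj).
  rewrite (@side_strand k n) ?kn ?leqnn // s810.
  by apply/esym/sideP; rewrite ?coreS ?hi ?kn ?leqnn.
have {}noS l : l <= n -> strand l \notin S.
  by move=> ln; apply/negP => Sl; apply: noS; exists l.
exists (side (strand 0)); split.
- by move=> S8; apply: sideP => //; apply: noS.
- have -> : side (strand 0) = side (strand n).
    by apply: side_strand; rewrite ?leqnn // => l /andP[_ /noS].
  by move=> S10; apply: sideP => //; apply: noS.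
- move=> k kn _; symmetry; apply: side_strand => // l /andP[_ lk].
  exact/noS/(leq_trans lk).
Qed.

Lemma side_gadget x y : gadget x = gadget y -> x \notin S -> y \notin S -> side x = side y.
Proof.
case: (eqVneq (gadget x) 2) => [gx gy|]; first by apply: side_gadget2; rewrite -?gy.
case: x y => [i|k] [j|l] //= i2 gij; last by rewrite gij in i2.
have [<-//|/eqP ij] := eqVneq i j.
apply: sideP; rewrite /= /core_adj gij eqxx /= andbC.
have -> : (i : nat, j : nat) \notin [:: (8, 10); (10, 8)].
  by apply: contraNN i2; rewrite !inE => /orP[] /eqP[->].
by apply/eqP => /val_inj.
Qed.
End Sides.

Lemma ggraph_4connected n : k_connected (ggraph n) 4.
Proof.
apply: k_connected_of_cuts; first by rewrite card_sum !card_ord; lia.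
move=> S ltS u v uS vS.
have sideP x y : ggraph n x y -> x \notin S -> y \notin S ->
    connect (avoid (ggraph n) S) u x = connect (avoid (ggraph n) S) u y.
  move=> xy xS yS; apply: same_connect_r; first exact: sym_connect_sym (@avoid_sym _ _ _).
  by apply: connect1; apply/and3P.
apply: (side_of_gadgets (S := S) (side := connect (avoid (ggraph n) S) u)) uS vS _ => //.
by move=> x y; apply: side_gadget sideP x y.
Qed.

(** * Absence of 2-connected spanning plane subgraphs *)

Definition chosen (bits : seq bool) : seq (nat * nat) :=
  [seq if pb.2 then pb.1.1 else pb.1.2 | pb <- zip links bits].

Definition cuts (s : seq bool) (e : nat * nat) : bool :=
  nth false s (e.1 %/ 4) != nth false s (e.2 %/ 4).

(* [s] is the indicator sequence of a set of gadgets. *)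
Lemma chosen_bridge (bits : seq bool) : size bits = 6 ->
  exists s, [/\ has id s, has negb s, size s = 6 & count (cuts s) (chosen bits) <= 1].
Proof.
pose ok bs s := [&& has id s, has negb s & count (cuts s) (chosen bs) <= 1].
pose bools := fix bools n := if n is n'.+1
  then [seq b :: s | b <- [:: true; false], s <- bools n'] else [:: [::]].
suff H : forall b0 b1 b2 b3 b4 b5, has (ok [:: b0; b1; b2; b3; b4; b5]) (bools 6).
  case: bits => [|b0 [|b1 [|b2 [|b3 [|b4 [|b5 [|]]]]]]] //= _.
  have /hasP[s sb /and3P[s1 s2 s3]] := H b0 b1 b2 b3 b4 b5.
  exists s; split => //; apply/eqP.
  suff /allP /(_ s sb) : all (fun s => size s == 6) (bools 6) by [].
  by vm_compute.
(* All 64 ways to take one link out of each gadget are tried, each against the 64 sets of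
   gadgets. *)
by do 6!case; vm_compute.
Qed.

Lemma link_of i j : i < 24 -> core_adj i j -> i %/ 4 != j %/ 4 ->
  has (fun p => [|| p.1 == (i, j), p.1 == (j, i), p.2 == (i, j) | p.2 == (j, i)]) links.
Proof.
move=> li /andP[_ /orP[/andP[/eqP->]|/eqP-> _]]; first by rewrite eqxx.
exact: (@all_core (fun i => has (fun p => [|| p.1 == (i, mate i), p.1 == (mate i, i),
  p.2 == (i, mate i) | p.2 == (mate i, i)]) links) isT (Ordinal li)).
Qed.

(** [F] keeps at most one link of each crossing pair, so its links are among six chosen ones. Some
    set of gadgets is cut by at most one chosen link, and the end of that link inside the set is the
    only exit of [F] from it. *)
Lemma no_2connected n (F : sgraph (vtype n)) :
  subrel F (ggraph n) ->
  (forall e f, (e, f) \in links ->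
     ~~ (F (core n e.1) (core n e.2) && F (core n f.1) (core n f.2))) ->
  ~ k_connected F 2.
Proof.
move=> FG Flinks.
pose Fb (e : nat * nat) := F (core n e.1) (core n e.2).
(* When [F] lacks the first link of a pair, the second one is chosen, whether or not [F] has it. *)
pose bits := [seq Fb p.1 | p <- links].
have [s [/(has_nthP false)[g lg sg] /(has_nthP false)[g' lg' sg'] s6 cnt]] :=
  @chosen_bridge bits erefl.
rewrite s6 in lg lg'.
have F_chosen i j : F (core n i) (core n j) -> i < 24 -> j < 24 -> cuts s (i, j) ->
    exists2 e, e \in chosen bits & e = (i, j) \/ e = (j, i).
  move=> Fij li lj cij.
  have gij : i %/ 4 != j %/ 4 by apply: contraNneq cij => /= ->.
  have : ggraph n (core n i) (core n j) by exact: FG.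
  rewrite core_adjP // => /(link_of li)/(_ gij)/hasP[p pl pij].
  have Fji : F (core n j) (core n i) by rewrite adj_sym.
  have Fp : Fb p.1 || Fb p.2.
    by rewrite /Fb; case/or4P: pij => /eqP->; rewrite ?Fij ?Fji ?orbT.
  have NF : ~~ (Fb p.1 && Fb p.2) by apply: Flinks; case: (p) pl.
  exists (if Fb p.1 then p.1 else p.2).
    have -> : chosen bits = [seq if Fb p.1 then p.1 else p.2 | p <- links] by [].
    exact: map_f.
  have F1 : p.1 = (i, j) \/ p.1 = (j, i) -> Fb p.1 by rewrite /Fb => -[] ->.
  have F2 : p.2 = (i, j) \/ p.2 = (j, i) -> Fb p.2 by rewrite /Fb => -[] ->.
  case/or4P: pij => /eqP E; move: NF.
  - by rewrite F1; [left|left].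
  - by rewrite F1; [right|right].
  - by rewrite F2 ?andbT => [/negbTE->|]; left.
  - by rewrite F2 ?andbT => [/negbTE->|]; right.
pose A := [set x : vtype n | nth false s (gadget x)].
have FA x y : F x y -> x \in A -> y \notin A ->
    exists i j, [/\ x = core n i, y = core n j, i < 24, j < 24 & cuts s (i, j)].
  move=> /FG Gxy; rewrite !inE => xA yA.
  have : gadget x != gadget y by apply: contraNneq yA => <-.
  case: x y Gxy xA yA => [i|k] [j|l] //= Gxy xA yA gxy.
  - by exists i, j; rewrite -!coreE /cuts /= xA (negbTE yA); split.
  - by move: Gxy gxy; rewrite /strand_adj !inE => /orP[/orP[]/eqP->|/orP[]/eqP[->]].
  - by move: Gxy gxy; rewrite /strand_adj !inE => /orP[/orP[]/eqP->|/orP[]/eqP[->]].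
have [p pP] : exists p, forall x y, F x y -> x \in A -> y \notin A -> x = p.
  case L: [seq e <- chosen bits | cuts s e] => [|e L'].
    (* No edge of [F] leaves [A], so any vertex serves as [p]. *)
    exists (core n 0) => x y Fxy xA yA.
    have [i [j [xi yj li lj cij]]] := FA x y Fxy xA yA.
    rewrite xi yj in Fxy; have [e eb eij] := F_chosen i j Fxy li lj cij.
    have : e \in [seq e <- chosen bits | cuts s e].
      by rewrite mem_filter eb andbT; case: eij => -> //; rewrite /cuts eq_sym.
    by rewrite L.
  have {L'}L : [seq e <- chosen bits | cuts s e] = [:: e].
    by move: cnt; rewrite -size_filter L /=; case: L' {L}.
  exists (core n (if nth false s (e.1 %/ 4) then e.1 else e.2)) => x y Fxy xA yA.
  have [i [j [xi yj li lj cij]]] := FA x y Fxy xA yA.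
  move: xA yA; rewrite !inE {1}xi {1}yj !gadget_core // => xA yA.
  rewrite xi yj in Fxy; have [e' eb eij] := F_chosen i j Fxy li lj cij.
  have : e' \in [seq e <- chosen bits | cuts s e].
    by rewrite mem_filter eb andbT; case: eij => -> //; rewrite /cuts eq_sym.
  rewrite L inE xi => /eqP <-.
  by case: eij => -> /=; rewrite ?xA // (negbTE yA).
have inA i : i < 24 -> (core n i \in A) = nth false s (i %/ 4).
  by move=> li; rewrite inE gadget_core.
(* The first corner of gadget [g] serves as [u], or the next one if the first is [p]. *)
have [u uA up] : exists2 u, u \in A & u != p.
  have lt4 : g * 4 < 24 /\ g * 4 + 1 < 24 by lia.
  case: (eqVneq (core n (g * 4)) p) => [E|]; last first.
    by exists (core n (g * 4)); rewrite // inA ?mulnK //; lia.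
  exists (core n (g * 4 + 1)).
    by rewrite inA; [rewrite divnMDl ?addn0 | lia].
  rewrite -E; apply/eqP => /core_inj; rewrite !inE /=; lia.
apply: (not_2connected_of_bridge pP uA (v := core n (g' * 4))) => //.
by rewrite inA ?mulnK //; lia.
Qed.

(** * Segments in the plane *)

Import Order.TTheory GRing.Theory Num.Theory.
Import numFieldNormedType.Exports.
Local Open Scope classical_set_scope.
Local Open Scope ring_scope.
Local Delimit Scope Z_scope with BZ.

Section Segments.
Variable R : realType.
Implicit Types (P Q X : R * R) (l : R * R * R) (t s : R).

Definition seg P Q t : R * R := (P.1 + t * (Q.1 - P.1), P.2 + t * (Q.2 - P.2)).

Definition aff l X : R := l.1.1 * X.1 + l.1.2 * X.2 + l.2.

(** Twice the signed area of the triangle [P Q X]; its sign tells on which side of the line [PQ] the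
    point [X] lies. *)
Definition orient P Q X : R :=
  (Q.1 - P.1) * (X.2 - P.2) - (Q.2 - P.2) * (X.1 - P.1).

(* A line weakly separates the segments and does not contain both. *)
Definition line_separated P Q P' Q' : Prop := exists l,
  [/\ aff l P <= 0, aff l Q <= 0, 0 <= aff l P', 0 <= aff l Q' &
      aff l P + aff l Q < aff l P' + aff l Q'].

Definition properly_cross P Q P' Q' : Prop :=
  orient P Q P' * orient P Q Q' < 0 /\ orient P' Q' P * orient P' Q' Q < 0.

Lemma aff_seg l P Q t : aff l (seg P Q t) = (1 - t) * aff l P + t * aff l Q.
Proof. by rewrite /aff /seg /=; ring. Qed.

(** At a common point [aff l] would be both nonpositive and nonnegative, hence zero. The weights
    [t], [1 - t], [s], [1 - s] are positive, so it would vanish at all four ends, against the strict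
    inequality between the sums. *)
Lemma line_separated_disjoint P Q P' Q' t s : line_separated P Q P' Q' ->
  0 < t < 1 -> 0 < s < 1 -> seg P Q t <> seg P' Q' s.
Proof.
move=> [l [lP lQ lP' lQ' lt]] /andP[t0 t1] /andP[s0 s1] /(congr1 (aff l)).
rewrite !aff_seg; move: (aff l P) (aff l Q) (aff l P') (aff l Q') lP lQ lP' lQ' lt.
move=> a b c d a0 b0 c0 d0 lt E.
have a1 : (1 - t) * a <= 0 by rewrite mulr_ge0_le0 // subr_ge0 ltW.
have b1 : t * b <= 0 by rewrite mulr_ge0_le0 // ltW.
have c1 : 0 <= (1 - s) * c by rewrite mulr_ge0 // subr_ge0 ltW.
have d1 : 0 <= s * d by rewrite mulr_ge0 // ltW.
have /eqP : (1 - t) * a = 0 by lra.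
have /eqP : t * b = 0 by lra.
have /eqP : (1 - s) * c = 0 by lra.
have /eqP : s * d = 0 by lra.
by rewrite !mulf_eq0 => /orP[/eqP|/eqP] ? /orP[/eqP|/eqP] ? /orP[/eqP|/eqP] ? /orP[/eqP|/eqP] ?; lra.
Qed.

Lemma line_separated_sym P Q P' Q' : line_separated P Q P' Q' -> line_separated P' Q' P Q.
Proof.
case=> [[[a b] c]] []; rewrite /aff /= => ? ? ? ? ?.
by exists (- a, - b, - c); rewrite /aff /=; split; lra.
Qed.

Lemma line_separated_swap P Q P' Q' : line_separated P Q P' Q' -> line_separated Q P P' Q'.
Proof. by case=> l [? ? ? ? ?]; exists l; split; rewrite 1?addrC. Qed.

Lemma properly_cross_sym P Q P' Q' : properly_cross P Q P' Q' -> properly_cross P' Q' P Q.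
Proof. by case. Qed.

Lemma orient_swap P Q X : orient Q P X = - orient P Q X.
Proof. by rewrite /orient; ring. Qed.

Lemma properly_cross_swap P Q P' Q' : properly_cross P Q P' Q' -> properly_cross Q P P' Q'.
Proof.
by case=> H1 H2; split; [rewrite !(orient_swap P Q) mulrNN|rewrite mulrC].
Qed.

Lemma seg_swap P Q t : seg Q P t = seg P Q (1 - t).
Proof. by rewrite /seg; congr (_, _); ring. Qed.

Definition det P Q P' Q' : R :=
  (Q.1 - P.1) * (Q'.2 - P'.2) - (Q.2 - P.2) * (Q'.1 - P'.1).

Lemma det_neq0 P Q P' Q' : properly_cross P Q P' Q' -> det P Q P' Q' != 0.
Proof.
case=> H _; have -> : det P Q P' Q' = orient P Q Q' - orient P Q P'.
  by rewrite /det /orient; ring.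
by apply: contraTneq H => /subr0_eq ->; rewrite -leNgt -expr2 sqr_ge0.
Qed.

(** The ratio is the zero of the affine function with value [a] at 0 and [b] at 1. *)
Lemma opposite_ratio (a b : R) : a * b < 0 -> a - b != 0 /\ 0 < a / (a - b) < 1.
Proof.
move=> ab; have ab0 : a - b != 0.
  by apply: contraTneq ab => /subr0_eq ->; rewrite -leNgt -expr2 sqr_ge0.
split=> //; have [b0|b0|b0] := ltgtP b 0.
- have a0 : 0 < a by nra.
  have d0 : 0 < a - b by lra.
  by rewrite divr_gt0 //= ltr_pdivrMr // mul1r; lra.
- have a0 : a < 0 by nra.
  have d0 : 0 < b - a by lra.
  rewrite -[a / _]mulrNN -invrN opprB divr_gt0 //= ?oppr_gt0 //.
  by rewrite ltr_pdivrMr // mul1r; lra.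
- by rewrite b0 mulr0 ltxx in ab.
Qed.

Lemma properly_cross_meet P Q P' Q' : properly_cross P Q P' Q' ->
  exists t s, [/\ 0 < t < 1, 0 < s < 1 & seg P Q t = seg P' Q' s].
Proof.
move=> tr; have := det_neq0 tr.
case: tr => /opposite_ratio[n1 r1] /opposite_ratio[n2 r2] d0.
exists (orient P' Q' P / (orient P' Q' P - orient P' Q' Q)).
exists (orient P Q P' / (orient P Q P' - orient P Q Q')).
split=> //; rewrite /seg.
have e1 : orient P Q P' - orient P Q Q' = - det P Q P' Q' by rewrite /orient /det; ring.
have e2 : orient P' Q' P - orient P' Q' Q = det P Q P' Q' by rewrite /orient /det; ring.
rewrite e1 e2; move: d0; rewrite /orient /det; move: P Q P' Q' {n1 r1 n2 r2 e1 e2}.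
by move=> [p1 p2] [q1 q2] [p1' p2'] [q1' q2'] /= d0; congr (_, _); field.
Qed.

(** Subtracting the two equations shows that [t != t'] would make the segments parallel. *)
Lemma seg_meet_uniq P Q P' Q' t s t' s' : det P Q P' Q' != 0 ->
  seg P Q t = seg P' Q' s -> seg P Q t' = seg P' Q' s' -> t = t'.
Proof.
move=> d0 [e1 e2] [e1' e2']; apply/eqP; rewrite -subr_eq0.
apply: contraNT d0 => tt; apply/eqP; rewrite /det.
apply: (mulfI tt); rewrite mulr0.
have f1 : (t - t') * (Q.1 - P.1) = (s - s') * (Q'.1 - P'.1) by lra.
have f2 : (t - t') * (Q.2 - P.2) = (s - s') * (Q'.2 - P'.2) by lra.
by rewrite mulrBr !mulrA f1 f2; ring.
Qed.

Lemma seg_inj P Q : P != Q -> injective (seg P Q).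
Proof.
move=> PQ t s [e1 e2]; apply/eqP; rewrite -subr_eq0; apply: contraNT PQ => ts.
case: P Q e1 e2 => [p1 p2] [q1 q2] /= e1 e2.
have /(mulfI ts) E1 : (t - s) * p1 = (t - s) * q1 by lra.
have /(mulfI ts) E2 : (t - s) * p2 = (t - s) * q2 by lra.
by rewrite E1 E2.
Qed.

Lemma pair_continuous (T : topologicalType) (f g : T -> R) :
  continuous f -> continuous g -> continuous (fun x => (f x, g x)).
Proof.
move=> cf cg x.
exact: (@cvg_pair _ _ _ (nbhs x) (nbhs (f x)) (nbhs (g x)) _ _ _ f g (cf x) (cg x)).
Qed.

Lemma seg_continuous P Q : continuous (seg P Q).
Proof.
have lin (a b : R) : continuous (fun t : R => a + t * b).
  by move=> t; apply: cvgD; [exact: cvg_cst|apply: cvgM; [exact: cvg_id|exact: cvg_cst]].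
exact: pair_continuous.
Qed.

Lemma aff_continuous l : continuous (aff l).
Proof.
move=> z; apply: cvgD; last exact: cvg_cst.
apply: cvgD; apply: cvgM; try exact: cvg_cst; first exact: cvg_fst.
exact: cvg_snd.
Qed.

Lemma open_aff_gt0 l : open [set z | 0 < aff l z].
Proof.
rewrite (_ : mkset _ = aff l @^-1` [set x | 0 < x]) //.
by apply: open_comp; [move=> z _; apply: aff_continuous|exact: open_gt].
Qed.

(** Oblique coordinates, with the common point as origin and axes along the two segments, form the
    required chart. *)
Lemma crossing_point_seg P Q P' Q' t s : det P Q P' Q' != 0 ->
  0 < t < 1 -> 0 < s < 1 -> seg P Q t = seg P' Q' s ->
  crossing_point (seg P Q @` `]0, 1[) (seg P' Q' @` `]0, 1[) (seg P Q t).
Proof.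
move=> d0 /andP[t0 t1] /andP[s0 s1] E.
set p := seg P Q t in E *; set D := det P Q P' Q' in d0.
pose u := (Q.1 - P.1, Q.2 - P.2); pose w := (Q'.1 - P'.1, Q'.2 - P'.2).
(* [k] sends [z] to [p + z.1 u + z.2 w], and [h] inverts it by Cramer's rule with determinant
   [D]. *)
pose h1 : R * R * R := (w.2 / D, - w.1 / D, (w.1 * p.2 - w.2 * p.1) / D).
pose h2 : R * R * R := (- u.2 / D, u.1 / D, (u.2 * p.1 - u.1 * p.2) / D).
pose h (q : R * R) : R * R := (aff h1 q, aff h2 q).
pose k1 : R * R * R := (u.1, w.1, p.1).
pose k2 : R * R * R := (u.2, w.2, p.2).
pose k (z : R * R) : R * R := (aff k1 z, aff k2 z).
have hk q : k (h q) = q.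
  case: q => a b; rewrite /k /h /aff /= /u /w /=.
  by congr (_, _); rewrite /D /det; field; exact: d0.
have kh z : h (k z) = z.
  case: z => a b; rewrite /k /h /aff /= /u /w /=.
  by congr (_, _); rewrite /D /det; field; exact: d0.
(* [V] is the box of offsets that keep both parameters [t + z.1] and [s + z.2] in []0, 1[], so that
   inside it each axis belongs to its open segment. *)
pose V := [set z | 0 < aff (1, 0, t) z] `&` [set z | 0 < aff (-1, 0, 1 - t) z] `&`
  ([set z | 0 < aff (0, 1, s) z] `&` [set z | 0 < aff (0, -1, 1 - s) z]).
have VP z : V z <-> (0 < t + z.1 < 1) /\ (0 < s + z.2 < 1).
  by rewrite /V /aff /setI /=; split=> [[[? ?] [? ?]]|[/andP[? ?] /andP[? ?]]];
     split; lra.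
have openV : open V by do !apply: openI; apply: open_aff_gt0.
have hc : continuous h by apply: pair_continuous; apply: aff_continuous.
have kc : continuous k by apply: pair_continuous; apply: aff_continuous.
have hp : h p = (0, 0) by rewrite /h /aff /=; congr (_, _); field; exact: d0.
exists (h @^-1` V), V, h, k; split; [|split; [|move=> q Uq; split]].
- split=> //; split=> //; last 1 first.
  + by apply/VP; rewrite /= !addr0 t0 t1 s0 s1.
  + by apply: open_comp => // ? _; apply: hc.
  + by rewrite /= hp; apply/VP; rewrite /= !addr0 t0 t1 s0 s1.
- split; [exact: continuous_subspaceT|exact: continuous_subspaceT|by []|].
  by move=> q Vq; rewrite /= kh.
- split=> [[t' _ <-]|h20].
    by rewrite /h /aff /p /seg /u /=; field; exact: d0.
  have [tz _] := (VP _).1 Uq; exists (t + (h q).1); first by rewrite /= in_itv.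
  rewrite -[RHS]hk /k /aff h20 /p /seg /u /=.
  by congr (_, _); ring.
- split=> [[s' _ <-]|h10].
    by rewrite /h /aff /h1 E /seg /w /=; field; exact: d0.
  have [_ sz] := (VP _).1 Uq; exists (s + (h q).2); first by rewrite /= in_itv.
  rewrite -[RHS]hk /k /aff h10 /k1 /k2 E /seg /w /=.
  by congr (_, _); ring.
Qed.

Lemma crossing_point_meet (A B : set (R * R)) q : crossing_point A B q -> A q /\ B q.
Proof.
case=> U [V [h [k [[[_ Uq] _ hq] [_ AB]]]]].
by have [Aq Bq] := AB q Uq; split; [apply/Aq|apply/Bq]; rewrite hq.
Qed.

End Segments.

(** * Straight-line drawings *)

Lemma set2_eq (T : finType) (a b c d : T) : [set a; b]%SET = [set c; d]%SET ->
  (a = c /\ b = d) \/ (a = d /\ b = c).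
Proof.
move=> E; have := set21 c d; have := set22 c d; rewrite -E => da ca.
have := set21 a b; have := set22 a b; rewrite E; move: da ca.
by move=> /set2P[?|?] /set2P[?|?] /set2P[?|?] /set2P[?|?]; subst; auto.
Qed.

Section StraightLine.
Variables (R : realType) (T : finType) (G : sgraph T) (pos : T -> R * R).
Variable crossing : T -> T -> T -> T -> bool.
Hypothesis crossing_edges : forall x y z w, crossing x y z w -> G x y /\ G z w.
Hypothesis crossing_disjoint : forall x y z w, crossing x y z w ->
  [&& x != z, x != w, y != z & y != w].
Hypothesis crossing_uniq : forall x y z w x' y' z' w',
  crossing x y z w -> crossing x' y' z' w' ->
  [set x; y]%SET = [set x'; y']%SET -> [set z; w]%SET = [set z'; w']%SET.
Hypothesis crossing_proper : forall x y z w, crossing x y z w ->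
  properly_cross (pos x) (pos y) (pos z) (pos w).
(* A vertex is treated as the degenerate edge [x = y]. *)
Hypothesis noncrossing_separated : forall x y z w,
  (x == y) || G x y -> (z == w) || G z w -> [set x; y]%SET != [set z; w]%SET ->
  ~~ crossing x y z w -> line_separated (pos x) (pos y) (pos z) (pos w).

(** An edge is an unordered pair, so [pick] fixes one of its orientations; the constant value is for
    sets that are not edges. *)
Definition straight_arc (e : {set T}) : R -> R * R :=
  if [pick xy | G xy.1 xy.2 && (e == [set xy.1; xy.2]%SET)] is Some xy
  then seg (pos xy.1) (pos xy.2) else fun=> (0, 0).

Lemma straight_arcP e : e \in edges G -> exists x y,
  [/\ G x y, e = [set x; y]%SET & straight_arc e = seg (pos x) (pos y)].
Proof.
rewrite inE => /existsP[x /existsP[y /andP[Gxy /eqP->]]]; rewrite /straight_arc.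
case: pickP => [[a b] /= /andP[Gab /eqP E]|/(_ (x, y))]; first by exists a, b.
by rewrite /= Gxy eqxx.
Qed.

Lemma half_itv : 0 < (2^-1 : R) < 1. Proof. by apply/andP; split; lra. Qed.

Lemma seg_point (P : R * R) t : seg P P t = P.
Proof. by rewrite /seg !subrr !mulr0 !addr0; case: P. Qed.

(** Two vertices are two degenerate segments, which a separating line keeps apart. *)
Lemma straight_point_inj : injective pos.
Proof.
move=> x y xy; apply/eqP; apply: contraT => nxy.
have sxy : line_separated (pos x) (pos x) (pos y) (pos y).
  apply: noncrossing_separated; rewrite ?eqxx //.
    apply: contraNneq nxy => /setP/(_ x); rewrite !inE eqxx /=.
    by rewrite orbb => /esym.
  by apply/negP => /crossing_edges[]; rewrite adj_irr.
by case: (line_separated_disjoint sxy half_itv half_itv); rewrite !seg_point.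
Qed.

Lemma straight_arc_continuous e : e \in edges G ->
  {within `[0, 1], continuous (straight_arc e)}.
Proof.
by case/straight_arcP=> x [y [_ _ ->]]; apply/continuous_subspaceT/seg_continuous.
Qed.

Lemma straight_arc_inj e : e \in edges G -> {in `[0, 1] &, injective (straight_arc e)}.
Proof.
case/straight_arcP=> x [y [Gxy _ ->]] t s _ _; apply: seg_inj.
by apply: contraTneq Gxy => /straight_point_inj ->; rewrite adj_irr.
Qed.

Lemma straight_arc_ends e : e \in edges G -> exists x y,
  [/\ e = [set x; y]%SET, straight_arc e 0 = pos x & straight_arc e 1 = pos y].
Proof.
case/straight_arcP=> x [y [_ -> ->]]; exists x, y; split=> //; rewrite /seg.
  by rewrite !mul0r !addr0; case: (pos x).
by rewrite !mul1r ![_ + (_ - _)]addrC !subrK; case: (pos y).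
Qed.

Lemma straight_arc_avoids e : e \in edges G -> forall v,
  ~ (straight_arc e @` `]0, 1[) (pos v).
Proof.
case/straight_arcP=> x [y [Gxy _ ->]] v [t]; rewrite /= in_itv /= => t01.
rewrite -(seg_point (pos v) 2^-1); apply: line_separated_disjoint t01 half_itv.
apply: noncrossing_separated; rewrite ?eqxx ?Gxy ?orbT //.
  apply: contraTneq Gxy => E; have : x \in [set v; v]%SET by rewrite -E !inE eqxx.
  have : y \in [set v; v]%SET by rewrite -E !inE eqxx orbT.
  by rewrite !inE !orbb => /eqP-> /eqP->; rewrite adj_irr.
by apply/negP => /crossing_edges[_]; rewrite adj_irr.
Qed.

Lemma straight_arc_meet e f p : e \in edges G -> f \in edges G -> e != f ->
  (straight_arc e @` `]0, 1[) p -> (straight_arc f @` `]0, 1[) p ->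
  exists x y z w, [/\ e = [set x; y]%SET, f = [set z; w]%SET,
    crossing x y z w & straight_arc e = seg (pos x) (pos y) /\
    straight_arc f = seg (pos z) (pos w)].
Proof.
case/straight_arcP=> x [y [Gxy -> ->]]; case/straight_arcP=> z [w [Gzw -> ->]] ef.
case=> t; rewrite /= in_itv /= => t01 <- [s]; rewrite in_itv /= => s01 st.
exists x, y, z, w; split=> //; apply: contraT => nX; exfalso.
suff /line_separated_disjoint/(_ t01 s01) :
    line_separated (pos x) (pos y) (pos z) (pos w) by rewrite st.
by apply: noncrossing_separated; rewrite ?Gxy ?Gzw ?orbT.
Qed.

Lemma straight_arc_crossing e f : e \in edges G -> f \in edges G -> e != f ->
  forall p, (straight_arc e @` `]0, 1[) p -> (straight_arc f @` `]0, 1[) p ->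
  crossing_point (straight_arc e @` `]0, 1[) (straight_arc f @` `]0, 1[) p.
Proof.
move=> eG fG ef p ep fp.
have [x [y [z [w [_ _ X [Ee Ef]]]]]] := straight_arc_meet eG fG ef ep fp.
move: ep fp; rewrite Ee Ef => -[t]; rewrite /= in_itv /= => t01 <- [s].
rewrite in_itv /= => s01 st.
by apply: crossing_point_seg (det_neq0 (crossing_proper X)) t01 s01 _.
Qed.

Definition straight_drawing : drawing R G :=
  Drawing straight_point_inj straight_arc_continuous straight_arc_inj
    straight_arc_ends straight_arc_avoids straight_arc_crossing.

Lemma straight_one_crossing e f g p q :
  cross_at straight_drawing e f p -> cross_at straight_drawing e g q -> f = g /\ p = q.
Proof.
case=> eG fG ef cp [_ gG eg cq].
have [ep fp] := crossing_point_meet cp; have [eq gq] := crossing_point_meet cq.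
have [x [y [z [w [Exy Ezw X [Ee Ef]]]]]] := straight_arc_meet eG fG ef ep fp.
have [x' [y' [z' [w' [Exy' Ezw' X' _]]]]] := straight_arc_meet eG gG eg eq gq.
have fg : f = g by rewrite Ezw Ezw'; apply: crossing_uniq X X' _; rewrite -Exy.
split=> //; move: ep fp eq gq; rewrite -fg /= Ee Ef.
case=> t _ <- [s _ st] [t' _ <-] [s' _ st'].
by rewrite (seg_meet_uniq (det_neq0 (crossing_proper X)) (esym st) (esym st')).
Qed.

Lemma straight_adjacent_no_cross x y z :
  ~ cross straight_drawing [set x; y]%SET [set x; z]%SET.
Proof.
case=> p [eG fG ef cp]; have [ep fp] := crossing_point_meet cp.
have [a [b [c [d [Eab Ecd /crossing_disjoint/and4P[ac ad bc bd] _]]]]] :=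
  straight_arc_meet eG fG ef ep fp.
have : x \in [set a; b]%SET by rewrite -Eab !inE eqxx.
have : x \in [set c; d]%SET by rewrite -Ecd !inE eqxx.
by rewrite !inE => /orP[/eqP->|/eqP->];
  rewrite [_ == a]eq_sym [_ == b]eq_sym ?(negbTE ac) ?(negbTE ad) ?(negbTE bc) ?(negbTE bd).
Qed.

Definition straight_oneplane : oneplane_graph R :=
  OnePlaneGraph straight_one_crossing straight_adjacent_no_cross.

Lemma straight_cross x y z w : crossing x y z w ->
  cross straight_drawing [set x; y]%SET [set z; w]%SET.
Proof.
move=> X; have [Gxy Gzw] := crossing_edges X.
have eG : [set x; y]%SET \in edges G.
  by rewrite inE; apply/existsP; exists x; apply/existsP; exists y; rewrite Gxy eqxx.
have fG : [set z; w]%SET \in edges G.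
  by rewrite inE; apply/existsP; exists z; apply/existsP; exists w; rewrite Gzw eqxx.
have ef : [set x; y]%SET != [set z; w]%SET.
  have /and4P[xz xw _ _] := crossing_disjoint X.
  by apply/eqP => /setP/(_ x); rewrite !inE eqxx (negbTE xz) (negbTE xw).
(* [straight_arc] may traverse the edge in the opposite direction, with the same image. *)
have img a b : [set a; b]%SET \in edges G -> forall q,
    (seg (pos a) (pos b) @` `]0, 1[) q -> (straight_arc [set a; b]%SET @` `]0, 1[) q.
  case/straight_arcP=> a' [b' [_ E ->]] q [t].
  rewrite /= in_itv /= => t01 <-.
  case: (set2_eq E) => -[-> ->]; first by exists t => //=; rewrite in_itv.
  by exists (1 - t); rewrite -?seg_swap //= in_itv /=; lra.
have [t [s [t01 s01 st]]] := properly_cross_meet (crossing_proper X).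
exists (seg (pos x) (pos y) t); split => //; apply: straight_arc_crossing => //.
  by apply: img => //; exists t => //=; rewrite in_itv.
by apply: img => //; rewrite st; exists s => //=; rewrite in_itv.
Qed.
End StraightLine.

(** * The drawing of the graphs *)

(** Gadget 2 is the square with corners at distance 4 from the origin on the axes. Its vertical
    diagonal carries the strand, whose first edge crosses the horizontal diagonal 9-11 at the
    origin. *)
Definition core_pt (i : nat) : Z * Z := nth (0, 0)%BZ [::
  (3, -9); (7, -9); (11, -13); (11, -17);
  (17, -11); (13, -11); (9, -7); (9, -3);
  (0, -4); (-4, 0); (0, 4); (4, 0);
  (20, -16); (24, -20); (20, -24); (16, -20);
  (-13, -1); (-4, -8); (12, -24); (35, -49);
  (33, -19); (24, -12); (8, 4); (-15, 29)]%BZ i.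

Definition swap (T : Type) (e : T * T) : T * T := (e.2, e.1).

(* Vertices are numbered as in [vcode] below; 24 is the first vertex of the
   strand. *)
Definition crossing_pairs : seq ((nat * nat) * (nat * nat)) :=
  links ++ [:: ((0, 2), (1, 3)); ((4, 6), (5, 7)); ((9, 11), (8, 24));
    ((12, 14), (13, 15)); ((16, 18), (17, 19)); ((20, 22), (21, 23))]%N.

(** Edges are unordered and crossing is symmetric, so all eight forms of each pair are listed. *)
Definition crossings : seq ((nat * nat) * (nat * nat)) :=
  let sym1 := [seq (swap p.1, p.2) | p <- crossing_pairs] ++ crossing_pairs in
  let sym2 := [seq (p.1, swap p.2) | p <- sym1] ++ sym1 in
  [seq swap p | p <- sym2] ++ sym2.

Definition zaff (l : Z * Z * Z) (p : Z * Z) : Z := l.1.1 * p.1 + l.1.2 * p.2 + l.2.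

Definition zopp (l : Z * Z * Z) : Z * Z * Z := (- l.1.1, - l.1.2, - l.2).

Definition zline (p q : Z * Z) : Z * Z * Z :=
  (- (q.2 - p.2), q.1 - p.1, (q.2 - p.2) * p.1 - (q.1 - p.1) * p.2).

(** Minus the scalar product with [q - p], taken from [p]: it vanishes on the perpendicular to [pq]
    at [p] and is negative on the side of [q]. *)
Definition znormal (p q : Z * Z) : Z * Z * Z :=
  (- (q.1 - p.1), - (q.2 - p.2), p.1 * (q.1 - p.1) + p.2 * (q.2 - p.2)).

Definition zlines (p q : Z * Z) : seq (Z * Z * Z) :=
  [:: zline p q; zopp (zline p q); znormal p q; znormal q p].

(** The candidates are the lines through either segment and the perpendiculars at its ends. For two
    vertices, as degenerate segments, these all vanish identically, and the last candidate takes
    over. *)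
Definition zseparated (p q p' q' : Z * Z) : bool :=
  has (fun l => [&& zaff l p <= 0, zaff l q <= 0, 0 <= zaff l p', 0 <= zaff l q' &
                    zaff l p + zaff l q < zaff l p' + zaff l q'])
    (zlines p q ++ [seq zopp l | l <- zlines p' q'] ++ [:: zopp (znormal p p')]).

Definition zproper (p q p' q' : Z * Z) : bool :=
  (zaff (zline p q) p' * zaff (zline p q) q' < 0) &&
  (zaff (zline p' q') p * zaff (zline p' q') q < 0).

(* [l] leaves the square with corners 8, 9, 10, 11 on its nonpositive side,
   the interior of the square strictly so. *)
Definition zoff_square (p q : Z * Z) : bool :=
  has (fun l => [&& l.2 < 0, all (fun i => zaff l (core_pt i) <= 0) [:: 8; 9; 10; 11]%N,
                    0 <= zaff l p & 0 <= zaff l q])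
    ([seq zopp l | l <- zlines p q] ++
     (* These are the lines along the four sides of the square. *)
     [:: (1, 1, -4); (1, -1, -4); (-1, 1, -4); (-1, -1, -4)]%BZ).

(* Core edges and, as pairs (i, i), core vertices. *)
Definition core_items : seq (nat * nat) :=
  [seq e : nat * nat <- [seq (i, j) | i <- iota 0 24, j <- iota 0 24] |
     (e.1 <= e.2)%N && ((e.1 == e.2) || core_adj e.1 e.2)].

Lemma mem_core_items i j : ((i, j) \in core_items) =
  [&& (i < 24)%N, (j < 24)%N, (i <= j)%N & (i == j) || core_adj i j].
Proof.
rewrite mem_filter andbC [RHS]andbA; congr (_ && _).
apply/allpairsPdep/idP => [[a [b []]]|/andP[li lj]].
  by rewrite !mem_iota /= => la lb [-> ->]; rewrite la lb.
by exists i, j; rewrite !mem_iota.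
Qed.

Lemma core_separated : all (fun e => all (fun f =>
    if zseparated (core_pt e.1) (core_pt e.2) (core_pt f.1) (core_pt f.2) then true
    else (e == f) || ((e, f) \in crossings)) core_items) core_items.
Proof. by vm_compute. Qed.

(** The content of the square depends on [n]; this computation shields all core items but 9-11 from
    it, uniformly in [n]. *)
Lemma core_off_square : all (fun e =>
    zoff_square (core_pt e.1) (core_pt e.2) || (e == (9, 11)%N)) core_items.
Proof. by vm_compute. Qed.

Definition strand_crossing (p : (nat * nat) * (nat * nat)) : bool :=
  (p.1 \in [:: (9, 11); (11, 9)]%N) && (p.2 \in [:: (8, 24); (24, 8)]%N).

(** The crossing of 9-11 with the first strand edge is set apart, because the position of vertex 24
    depends on [n]. *)
Lemma crossings_proper : all (fun p : (nat * nat) * (nat * nat) =>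
    [|| [&& p.1.1 < 24, p.1.2 < 24, p.2.1 < 24, p.2.2 < 24 &
         zproper (core_pt p.1.1) (core_pt p.1.2) (core_pt p.2.1) (core_pt p.2.2)]%N,
     strand_crossing p | strand_crossing (swap p)]) crossings.
Proof. by vm_compute. Qed.

Lemma crossings_swap : all (fun p => [&& (swap p.1, p.2) \in crossings,
  (p.1, swap p.2) \in crossings & swap p \in crossings]) crossings.
Proof. by vm_compute. Qed.

Lemma crossings_uniq : all (fun p => all (fun q =>
    ((p.1 == q.1) || (p.1 == swap q.1)) ==> ((p.2 == q.2) || (p.2 == swap q.2)))
  crossings) crossings.
Proof. by vm_compute. Qed.

Lemma crossings_disjoint : all (fun p =>
  [&& p.1.1 != p.2.1, p.1.1 != p.2.2, p.1.2 != p.2.1 & p.1.2 != p.2.2]) crossings.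
Proof. by vm_compute. Qed.

Lemma crossings_edges : all (fun p =>
   all (fun e : nat * nat => [&& e.1 < 24, e.2 < 24 & core_adj e.1 e.2]%N ||
     (e \in [:: (8, 24); (24, 8)]%N)) [:: p.1; p.2]) crossings.
Proof. by vm_compute. Qed.

(** * From integer tests to the real plane *)

Section Transfer.
Variable R : realType.

Definition zr (z : Z) : R := (int_of_Z z)%:~R.
Definition zpoint (p : Z * Z) : R * R := (zr p.1, zr p.2).

Lemma zr_le z z' : z <= z' -> zr z <= zr z'.
Proof. by move=> zz; rewrite /zr ler_int; lia. Qed.

Lemma zr_lt z z' : z < z' -> zr z < zr z'.
Proof. by move=> zz; rewrite /zr ltr_int; lia. Qed.

Lemma zrD z z' : zr (z + z') = zr z + zr z'. Proof. by rewrite /zr !rmorphD. Qed.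
Lemma zrM z z' : zr (z * z') = zr z * zr z'. Proof. by rewrite /zr !rmorphM. Qed.
Lemma zrN z : zr (- z) = - zr z. Proof. by rewrite /zr !rmorphN. Qed.

Lemma zr_aff l p : aff (zpoint l.1, zr l.2) (zpoint p) = zr (zaff l p).
Proof. by rewrite /zaff !zrD !zrM. Qed.

Lemma zr_line p q p' : orient (zpoint p) (zpoint q) (zpoint p') = zr (zaff (zline p q) p').
Proof. by rewrite -zr_aff /aff /orient /= !(zrD, zrN, zrM); ring. Qed.

Lemma zseparatedP p q p' q' : zseparated p q p' q' ->
  line_separated (zpoint p) (zpoint q) (zpoint p') (zpoint q').
Proof.
case/hasP => l _ /and5P[/zr_le lp /zr_le lq /zr_le lp' /zr_le lq' /zr_lt lt].
by exists (zpoint l.1, zr l.2); rewrite !zr_aff -!zrD; split.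
Qed.

Lemma zproperP p q p' q' : zproper p q p' q' ->
  properly_cross (zpoint p) (zpoint q) (zpoint p') (zpoint q').
Proof. by case/andP=> /zr_lt H /zr_lt H'; split; rewrite !zr_line -zrM. Qed.
End Transfer.


(** * Vertex positions and separation inside the square *)

Section Positions.
Variables (R : realType) (n : nat).
Local Notation vtx := (vtype n).

Definition vcode (x : vtx) : nat :=
  match x with inl i => i | inr k => 24 + k end.

(** The upper half of the vertical diagonal is divided into [n.+2] equal parts; the strand takes the
    inner division points, all of them above 9-11. *)
Definition height (r : nat) : R := 4 * r%:R / n.+2%:R.

Definition vpos (x : vtx) : R * R :=
  match x with inl i => zpoint R (core_pt i) | inr k => (0, height k.+1) end.

Definition vcrossing (x y z w : vtx) : bool :=
  ((vcode x, vcode y), (vcode z, vcode w)) \in crossings.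

Lemma vcode_inj : injective vcode.
Proof.
move=> [i|k] [j|l] /= E.
- by congr inl; apply: val_inj.
- by have := ltn_ord i; rewrite E; lia.
- by have := ltn_ord j; rewrite -E; lia.
- by congr inr; apply: val_inj => /=; lia.
Qed.

(* The points of the diagonal of the square, from bottom to top. *)
Definition rail (r : nat) : vtx :=
  if r == 0%N then core n 8 else if r == n.+2 then core n 10 else inr (inord r.-1).

(** Index 0 is corner 8 and not the centre of the square, so only the first rail edge crosses
    9-11. *)
Definition rail_height (r : nat) : R := if r == 0%N then -4 else height r.

Lemma vpos_core i : (i < 24)%N -> vpos (core n i) = zpoint R (core_pt i).
Proof. by move=> li; rewrite /= inordK. Qed.

Lemma vpos_left : vpos (core n 9) = (-4, 0). Proof. by rewrite vpos_core. Qed.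
Lemma vpos_right : vpos (core n 11) = (4, 0). Proof. by rewrite vpos_core. Qed.

Lemma height_lt r s : (r < s)%N -> height r < height s.
Proof.
by move=> rs; rewrite /height ltr_pM2r ?invr_gt0 ?ltr0n // ltr_pM2l ?ltr0n // ltr_nat.
Qed.

Lemma height0 : height 0 = 0. Proof. by rewrite /height mulr0 mul0r. Qed.

Lemma height_top : height n.+2 = 4.
Proof. by rewrite /height mulfK // pnatr_eq0. Qed.

Lemma rail_height_lt r s : (r < s)%N -> rail_height r < rail_height s.
Proof.
rewrite /rail_height; case: eqP => [->|_] rs; last first.
  by case: eqP rs => [->|_] // rs; apply: height_lt.
by rewrite gtn_eqF //; have := height_lt rs; rewrite height0; lra.
Qed.

Lemma rail_height_le r s : (r <= s)%N -> rail_height r <= rail_height s.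
Proof. by rewrite leq_eqVlt => /predU1P[->//|/rail_height_lt/ltW]. Qed.

Lemma vpos_rail r : (r <= n.+2)%N -> vpos (rail r) = (0, rail_height r).
Proof.
rewrite /rail /rail_height => rn; case: eqP => [_|r0]; first by rewrite vpos_core.
case: eqP => [->|rtop]; first by rewrite vpos_core // height_top.
by rewrite /= inordK ?prednK //; lia.
Qed.

Lemma rail_height_bounds r : (r <= n.+2)%N -> -4 <= rail_height r <= 4.
Proof.
move=> rn; have bot : -4 <= rail_height r := rail_height_le (leq0n r).
by rewrite bot -height_top; apply: (rail_height_le rn).
Qed.

Lemma rail_height_inner r : (0 < r < n.+2)%N -> 0 < rail_height r < 4.
Proof.
case/andP=> r0 rn; rewrite -height_top -height0 /rail_height gtn_eqF //.
by rewrite !height_lt.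
Qed.

Lemma strand_rail (k : 'I_n.+1) : inr k = rail k.+1.
Proof. by rewrite /rail /= eqSS ltn_eqF // inord_val. Qed.

(* Edges and vertices inside the square of gadget 2, up to orientation. *)
Variant inner_item (x y : vtx) : Prop :=
| InnerRail r s of x = rail r & y = rail s & (r <= s <= r.+1)%N & (s <= n.+2)%N &
    (r < n.+2)%N & (0 < s)%N
| InnerSpoke h r of h \in [:: 9; 11]%N & x = core n h & y = rail r & (0 < r < n.+2)%N.

Lemma inner_itemP (x y : vtx) (k : 'I_n.+1) : (y == inr k) || ggraph n (inr k) y ->
  inner_item (inr k) y \/ inner_item y (inr k).
Proof.
have ltk := ltn_ord k; rewrite !strand_rail => /orP[/eqP->|].
  by left; apply: InnerRail; rewrite ?leqnn ?leqnSn //; lia.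
rewrite -strand_rail; case: y => [i|l] /=.
  rewrite coreE strand_rail /strand_adj !inE => /orP[i911|].
    by right; apply: (@InnerSpoke _ _ i k.+1) => //; rewrite !inE.
  rewrite !xpair_eqE => /orP[] /andP[/eqP-> /eqP->].
    by right; apply: (@InnerRail _ _ 0 1).
  left; apply: (@InnerRail _ _ n.+1 n.+2) => //; try lia.
  by rewrite /rail /= eqxx.
have ltl := ltn_ord l; rewrite !strand_rail => /orP[] /eqP E.
  by left; apply: (@InnerRail _ _ k.+1 l.+1) => //; lia.
by right; apply: (@InnerRail _ _ l.+1 k.+1) => //; lia.
Qed.

(** [l.2] is the value at the centre of the square. Being negative there and nonpositive at the
    corners, [aff l] is negative on the open vertical diagonal, where every inner item has an end;
    this gives strictness. *)
Lemma inner_off_square (l : R * R * R) x y z w : l.2 < 0 ->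
  (forall i, i \in [:: 8; 9; 10; 11]%N -> aff l (zpoint R (core_pt i)) <= 0) ->
  0 <= aff l (vpos z) -> 0 <= aff l (vpos w) ->
  inner_item x y -> line_separated (vpos x) (vpos y) (vpos z) (vpos w).
Proof.
move=> l0 corner lz lw inn.
have c8 : aff l (0, -4) <= 0 by apply: (corner 8%N).
have c9 : aff l (-4, 0) <= 0 by apply: (corner 9%N).
have c10 : aff l (0, 4) <= 0 by apply: (corner 10%N).
have c11 : aff l (4, 0) <= 0 by apply: (corner 11%N).
have le t : -4 <= t <= 4 -> aff l (0, t) <= 0.
  by case/andP=> ? ?; move: c8 c10; rewrite /aff /= => ? ?; nra.
have lt t : -4 < t < 4 -> aff l (0, t) < 0.
  case/andP=> t1 t2; move: c8 c10 l0; rewrite /aff /= => c8 c10 l0.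
  have [b0|b0|b0] := ltgtP l.1.2 0; last by rewrite b0; lra.
    by have : 0 < - l.1.2 * (t + 4) by [apply: mulr_gt0; lra]; lra.
  by have : 0 < l.1.2 * (4 - t) by [apply: mulr_gt0; lra]; lra.
case: inn => [r s -> -> /andP[rs sr] sn rn s0|h r h911 -> -> r0].
  rewrite !vpos_rail ?(leq_trans rs) //.
  have ler := le _ (rail_height_bounds (leq_trans rs sn)).
  have les := le _ (rail_height_bounds sn).
  exists l; split => //; apply: lt_le_trans (addr_ge0 lz lw).
  have [r0|r0] := posnP r.
    have s1 : (0 < s < n.+2)%N by rewrite s0; lia.
    have /lt : -4 < rail_height s < 4.
      by have := rail_height_inner s1; lra.
    lra.
  have r1 : (0 < r < n.+2)%N by rewrite r0.
  have /lt : -4 < rail_height r < 4.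
    by have := rail_height_inner r1; lra.
  lra.
have /lt ltr : -4 < rail_height r < 4.
  by have := rail_height_inner r0; lra.
rewrite vpos_rail; last by case/andP: r0 => _ /ltnW.
have lh : aff l (vpos (core n h)) <= 0.
  by move: h911; rewrite !inE => /orP[] /eqP->; rewrite ?vpos_left ?vpos_right.
exists l; split => //; [exact: ltW | apply: lt_le_trans (addr_ge0 lz lw); lra].
Qed.

(** Every inner item but the first rail edge lies in the closed upper half-plane and has an end
    strictly above the horizontal diagonal, which thus separates. *)
Lemma inner_axis x y : inner_item x y -> (x, y) <> (rail 0, rail 1) ->
  line_separated (vpos x) (vpos y) (vpos (core n 9)) (vpos (core n 11)).
Proof.
rewrite vpos_left vpos_right => -[r s -> -> /andP[rs sr] sn rn s0|h r h911 -> -> r0] ne.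
  rewrite !vpos_rail ?(leq_trans rs) //.
  have r0 : (0 < r)%N.
    rewrite lt0n; apply/eqP => r0; apply: ne; rewrite r0; congr (_, rail _); lia.
  have := @rail_height_inner r; rewrite r0 rn => /(_ isT) hr.
  have := rail_height_le rs => hs.
  by exists (0, -1, 0); rewrite /aff /=; split; lra.
have hr := rail_height_inner r0.
rewrite vpos_rail; last by case/andP: r0 => _ /ltnW.
by move: h911; rewrite !inE => /orP[] /eqP->; rewrite ?vpos_left ?vpos_right;
  exists (0, -1, 0); rewrite /aff /=; split; lra.
Qed.

Lemma rail_rail r s r' s' : (r <= s <= r.+1)%N -> (s <= n.+2)%N ->
  (r' <= s' <= r'.+1)%N -> (s' <= n.+2)%N -> (s <= r')%N -> (r, s) != (r', s') ->
  line_separated (vpos (rail r)) (vpos (rail s)) (vpos (rail r')) (vpos (rail s')).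
Proof.
move=> /andP[rs sr] sn /andP[rs' sr'] sn' le ne; rewrite !vpos_rail; try lia.
have h1 := rail_height_le rs; have h2 := rail_height_le le; have h3 := rail_height_le rs'.
exists (0, 1, - rail_height s); rewrite /aff /=; split; try lra.
have [rs1|sr1] := ltnP r s; first by have := rail_height_lt rs1; lra.
have [rs1|sr1'] := ltnP s r'; first by have := rail_height_lt rs1; lra.
have [rs1|sr1''] := ltnP r' s'; first by have := rail_height_lt rs1; lra.
by case/eqP: ne; congr (_, _); lia.
Qed.

Lemma rail_spoke r s h t : (r <= n.+2)%N -> (s <= n.+2)%N -> h \in [:: 9; 11]%N ->
  (t <= n.+2)%N ->
  line_separated (vpos (rail r)) (vpos (rail s)) (vpos (core n h)) (vpos (rail t)).
Proof.
move=> rn sn h911 tn; rewrite !vpos_rail //.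
move: h911; rewrite !inE => /orP[] /eqP->; rewrite ?vpos_left ?vpos_right.
  by exists (-1, 0, 0); rewrite /aff /=; split; lra.
by exists (1, 0, 0); rewrite /aff /=; split; lra.
Qed.

(** The line through the lower spoke separates. *)
Lemma spoke_spoke h r s : h \in [:: 9; 11]%N -> (0 < r < s)%N -> (s < n.+2)%N ->
  line_separated (vpos (core n h)) (vpos (rail r)) (vpos (core n h)) (vpos (rail s)).
Proof.
move=> h911 /andP[r0 rs] sn; rewrite !vpos_rail; try lia.
have hrs := rail_height_lt rs.
have h1 := @rail_height_inner r ltac:(lia).
move: h911; rewrite !inE => /orP[] /eqP->; rewrite ?vpos_left ?vpos_right.
  exists (- rail_height r, 4, -4 * rail_height r); rewrite /aff /=; split; lra.
exists (rail_height r, 4, -4 * rail_height r); rewrite /aff /=; split; lra.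
Qed.

Lemma spoke_spoke_opposite h h' r s : h \in [:: 9; 11]%N -> h' \in [:: 9; 11]%N ->
  h != h' -> (r <= n.+2)%N -> (s <= n.+2)%N ->
  line_separated (vpos (core n h)) (vpos (rail r)) (vpos (core n h')) (vpos (rail s)).
Proof.
move=> h911 h911' hh' rn sn; rewrite !vpos_rail //; move: h911 h911' hh'.
rewrite !inE => /orP[] /eqP-> /orP[] /eqP-> // _; rewrite vpos_left vpos_right.
  by exists (1, 0, 0); rewrite /aff /=; split; lra.
by exists (-1, 0, 0); rewrite /aff /=; split; lra.
Qed.

Lemma inner_inner x y z w : inner_item x y -> inner_item z w -> (x, y) != (z, w) ->
  line_separated (vpos x) (vpos y) (vpos z) (vpos w).
Proof.
case=> [r s -> -> rs sn rn s0|h r h911 -> -> /andP[r0 rn]];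
  case=> [r' s' -> -> rs' sn' rn' s0'|h' r' h911' -> -> /andP[r0' rn']] ne.
- have {}ne : (r, s) != (r', s') by apply: contraNneq ne => -[-> ->].
  have [le|lt] := leqP s r'; first exact: rail_rail.
  apply/line_separated_sym/rail_rail; rewrite // 1?eq_sym //.
  by move: ne; rewrite xpair_eqE; lia.
- by apply: rail_spoke => //; lia.
- by apply/line_separated_sym/rail_spoke => //; lia.
- have [hh'|hh'] := eqVneq h h'; last by apply: spoke_spoke_opposite => //; exact: ltnW.
  subst h'; have [lt|lt|E] := ltngtP r r'.
  + by apply: spoke_spoke => //; rewrite r0.
  + by apply/line_separated_sym/spoke_spoke => //; rewrite r0'.
  + by rewrite E eqxx in ne.
Qed.

Lemma vcode_core i : (i < 24)%N -> vcode (core n i) = i.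
Proof. by move=> li; rewrite /= inordK. Qed.

Lemma vcode_ltP x : (vcode x < 24)%N -> x = core n (vcode x).
Proof. by case: x => [i|k] /= lt; [rewrite coreE|lia]. Qed.

Lemma vcode24 x : vcode x = 24%N -> x = rail 1.
Proof.
move=> E; apply: vcode_inj; rewrite E; have := strand_rail ord0.
by move=> <-.
Qed.

Lemma vcrossing_edges x y z w :
  vcrossing x y z w -> ggraph n x y /\ ggraph n z w.
Proof.
move/(allP crossings_edges) => /= /and3P[xy zw _].
have edge a b : [&& vcode a < 24, vcode b < 24 & core_adj (vcode a) (vcode b)]%N
    || ((vcode a, vcode b) \in [:: (8, 24); (24, 8)]%N) -> ggraph n a b.
  case/orP=> [/and3P[la lb ab]|].
    by rewrite (vcode_ltP la) (vcode_ltP lb) core_adjP.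
  rewrite !inE => /orP[] /eqP[a8 b8].
    by rewrite (vcode_ltP (x := a)) ?a8 // (vcode24 b8) -(strand_rail ord0) /= inordK.
  by rewrite adj_sym (vcode_ltP (x := b)) ?b8 // (vcode24 a8) -(strand_rail ord0) /= inordK.
by split; apply: edge.
Qed.

Lemma vcrossing_disjoint x y z w :
  vcrossing x y z w -> [&& x != z, x != w, y != z & y != w].
Proof.
move/(allP crossings_disjoint) => /= /and4P[? ? ? ?].
by apply/and4P; split; rewrite -(inj_eq vcode_inj).
Qed.

Lemma vcrossing_uniq x y z w x' y' z' w' :
  vcrossing x y z w -> vcrossing x' y' z' w' ->
  [set x; y]%SET = [set x'; y']%SET -> [set z; w]%SET = [set z'; w']%SET.
Proof.
move=> X X' E; have := allP (allP crossings_uniq _ X) _ X'; rewrite /swap /=.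
case: (set2_eq E) => -[-> ->]; rewrite eqxx ?orbT /=;
  by case/orP => /eqP[/vcode_inj-> /vcode_inj->] //; rewrite finset.setUC.
Qed.

Lemma vcrossing_swapl x y z w : vcrossing x y z w -> vcrossing y x z w.
Proof. by move/(allP crossings_swap)/and3P=> []. Qed.

Lemma vcrossing_swapr x y z w : vcrossing x y z w -> vcrossing x y w z.
Proof. by move/(allP crossings_swap)/and3P=> []. Qed.

Lemma vcrossing_sym x y z w : vcrossing x y z w -> vcrossing z w x y.
Proof. by move/(allP crossings_swap)/and3P=> []. Qed.

Lemma strand_properly_cross : properly_cross (vpos (core n 9)) (vpos (core n 11))
  (vpos (rail 0)) (vpos (rail 1)).
Proof.
have h1 := @rail_height_inner 1 isT.
rewrite vpos_left vpos_right !vpos_rail // /properly_cross /orient /=.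
rewrite [rail_height 0]/rail_height /=; split; last by nra.
by nra.
Qed.

Lemma vcrossing_proper x y z w :
  vcrossing x y z w -> properly_cross (vpos x) (vpos y) (vpos z) (vpos w).
Proof.
have strand a b c d : strand_crossing ((vcode a, vcode b), (vcode c, vcode d)) ->
    properly_cross (vpos a) (vpos b) (vpos c) (vpos d).
  have c9 v : vcode v = 9%N -> v = core n 9 by move=> E; rewrite -E -vcode_ltP ?E.
  have c11 v : vcode v = 11%N -> v = core n 11 by move=> E; rewrite -E -vcode_ltP ?E.
  have c8 v : vcode v = 8%N -> v = rail 0 by move=> E; rewrite [v]vcode_ltP ?E.
  case/andP; rewrite !inE => /orP[] /eqP[ha hb] /orP[] /eqP[hc hd].
  - rewrite (c9 a) // (c11 b) // (c8 c) // (vcode24 hd).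
    exact: strand_properly_cross.
  - rewrite (c9 a) // (c11 b) // (c8 d) // (vcode24 hc).
    exact/properly_cross_sym/properly_cross_swap/properly_cross_sym/strand_properly_cross.
  - rewrite (c9 b) // (c11 a) // (c8 c) // (vcode24 hd).
    exact/properly_cross_swap/strand_properly_cross.
  - rewrite (c9 b) // (c11 a) // (c8 d) // (vcode24 hc).
    apply/properly_cross_swap/properly_cross_sym/properly_cross_swap.
    exact/properly_cross_sym/strand_properly_cross.
move/(allP crossings_proper)/or3P => [/and5P[lx ly lz lw /= /(zproperP R)]||].
- by rewrite (vcode_ltP lx) (vcode_ltP ly) (vcode_ltP lz) (vcode_ltP lw) !vpos_core ?vcode_core.
- exact: strand.
- by move/strand/properly_cross_sym.
Qed.

(** * Separation of all noncrossing pairs *)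

(** It fixes an orientation of each item, since [core_items] lists a core edge with its smaller end
    first. *)
Variant normal_item (x y : vtx) : Prop :=
| NormalInner of inner_item x y
| NormalCore i j of (i, j) \in core_items & x = core n i & y = core n j.

Lemma normal_itemP x y : (x == y) || ggraph n x y -> normal_item x y \/ normal_item y x.
Proof.
case: x y => [i|k] [j|l] xy.
- wlog le_ij : i j xy / (i <= j)%N.
    move=> wl; have [le|/ltnW le] := leqP i j; first exact: wl.
    have ji : (inl j == inl i :> vtx) || ggraph n (inl j) (inl i) by rewrite eq_sym adj_sym.
    by have [H|H] := wl j i ji le; [right|left].
  left; rewrite !coreE; apply: (NormalCore (i := i) (j := j)) => //.
  rewrite mem_core_items !ltn_ord le_ij /=.
  by case/orP: xy => [/eqP[->]|/= ->]; rewrite ?eqxx ?orbT.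
- have [H|H] := @inner_itemP (inl i) (inl i) l ltac:(by rewrite adj_sym).
    by right; apply: NormalInner.
  by left; apply: NormalInner.
- have [H|H] := @inner_itemP (inl j) (inl j) k ltac:(by []).
    by left; apply: NormalInner.
  by right; apply: NormalInner.
- have [H|H] := @inner_itemP (inr l) (inr l) k ltac:(by rewrite eq_sym).
    by left; apply: NormalInner.
  by right; apply: NormalInner.
Qed.

Lemma inner_core x y z w : inner_item x y ->
  (exists i j, [/\ (i, j) \in core_items, z = core n i & w = core n j]) ->
  ~~ vcrossing x y z w -> line_separated (vpos x) (vpos y) (vpos z) (vpos w).
Proof.
move=> inn [i [j [ij -> ->]]] nX.
have [li lj] : (i < 24 /\ j < 24)%N.
  by move: ij; rewrite mem_core_items => /and4P[].
have /orP[off|/eqP[i9 j11]] : zoff_square (core_pt i) (core_pt j) || ((i, j) == (9, 11)%N).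
    exact: (allP core_off_square _ ij).
  move: off; rewrite /zoff_square => /hasP[l _].
  case/and4P=> /(zr_lt R) l0 /allP corner /(zr_le R) lz /(zr_le R) lw.
  apply: (inner_off_square (l := (zpoint R l.1, zr R l.2))) => //.
  - by move=> k k4; rewrite zr_aff; apply: (zr_le R (corner k k4)).
  - by rewrite vpos_core // zr_aff.
  - by rewrite vpos_core // zr_aff.
rewrite i9 j11 in nX *; apply: inner_axis => // -[x0 y1].
by move: nX; rewrite /vcrossing x0 y1 -(strand_rail ord0) !vcode_core.
Qed.

Lemma normal_separated x y z w : normal_item x y -> normal_item z w ->
  (x, y) != (z, w) -> ~~ vcrossing x y z w ->
  line_separated (vpos x) (vpos y) (vpos z) (vpos w).
Proof.
case=> [ixy|i j ij xi yj] [izw|k l kl zk wl] ne nX.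
- exact: inner_inner.
- by apply: inner_core => //; exists k, l.
- apply/line_separated_sym/inner_core => //; first by exists i, j.
  by apply: contraNN nX; apply: vcrossing_sym.
have /and4P[li lj _ _] : [&& i < 24, j < 24, i <= j & (i == j) || core_adj i j]%N.
  by rewrite -mem_core_items.
have /and4P[lk ll _ _] : [&& k < 24, l < 24, k <= l & (k == l) || core_adj k l]%N.
  by rewrite -mem_core_items.
have := allP (allP core_separated _ ij) _ kl => /=.
rewrite xi yj zk wl !vpos_core //; case: ifP => [/zseparatedP //|_].
case/orP=> [/eqP[ik jl]|X]; first by rewrite xi yj zk wl ik jl eqxx in ne.
by move: nX; rewrite /vcrossing xi yj zk wl !vcode_core // X.
Qed.

Lemma vnoncrossing_separated x y z w :
  (x == y) || ggraph n x y -> (z == w) || ggraph n z w ->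
  [set x; y]%SET != [set z; w]%SET -> ~~ vcrossing x y z w ->
  line_separated (vpos x) (vpos y) (vpos z) (vpos w).
Proof.
move=> /normal_itemP[xy|xy] /normal_itemP[zw|zw] ne nX.
- apply: normal_separated => //; apply: contraNneq ne => -[-> ->].
  by [].
- apply/line_separated_sym/line_separated_swap/line_separated_sym/normal_separated => //.
    by apply: contraNneq ne => -[-> ->]; rewrite finset.setUC.
  by apply: contraNN nX; apply: vcrossing_swapr.
- apply/line_separated_swap/normal_separated => //.
    by apply: contraNneq ne => -[-> ->]; rewrite finset.setUC.
  by apply: contraNN nX; apply: vcrossing_swapl.
- apply/line_separated_swap/line_separated_sym/line_separated_swap/line_separated_sym.
  apply: normal_separated => //.
    by apply: contraNneq ne => -[-> ->].
  by apply: contraNN nX => /vcrossing_swapl/vcrossing_swapr.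
Qed.

Definition oneplane : oneplane_graph R :=
  straight_oneplane vcrossing_edges vcrossing_disjoint vcrossing_uniq
    vcrossing_proper vnoncrossing_separated.
End Positions.

Theorem theorem3 (R : realType) :
  exists G : nat -> oneplane_graph R,
    (forall i j : nat, i <> j -> ~ isomorphic (G i) (G j)) /\
    forall i : nat,
      k_connected (G i) 4 /\
      forall F : sgraph (vertex (G i)),
        spanning_plane_subgraph F -> ~ k_connected F 2.
Proof.
(* The graph with index [n] has [24 + n.+1] vertices, so different indices give non-isomorphic
   graphs. *)
exists (oneplane R); split=> [i j ij [f /bij_eq_card]|n].
  by rewrite /= !card_sum !card_ord => /addnI[].
split; first exact: ggraph_4connected.
move=> F [FG Fcross]; apply: no_2connected => // e f ef.
apply/negP => /andP[Fe Ff].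
have edgeF x y : F x y -> [set x; y]%SET \in edges F.
  move=> Fxy; rewrite inE; apply/existsP; exists x; apply/existsP; exists y.
  by rewrite Fxy /=.
apply: Fcross (edgeF _ _ Fe) (edgeF _ _ Ff) _;
  apply: straight_cross; first exact: vcrossing_disjoint.
(* The two links leaving a gadget form a crossing pair, so [F] cannot contain both. *)
have := allP (_ : all (fun p : (nat * nat) * (nat * nat) =>
  [&& p.1.1 < 24, p.1.2 < 24, p.2.1 < 24, p.2.2 < 24 & p \in crossings]%N) links) _ ef.
case/(_ isT)/and5P=> /= l1 l2 l3 l4; rewrite /vcrossing !vcode_core // -!surjective_pairing.
Qed.
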